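(* Let $\alpha>0$. For each $d\ge 1$ consider the linear bigram problem with vocabulary size $d$ whose token frequencies and conditional frequencies follow a power law with exponent $\alpha$, and run gradient descent from $\mathbf W_0=0$ with constant step-size $1/\pi_1$. Let $\mathcal L_d(t)$ be the loss after $t$ steps and $\mathcal L_d^*$ the minimum loss. For a time scaling $t_d(\tau)$ define the asymptotic rate $$r(\tau)=\lim_{d\to\infty}\frac{\mathcal L_d(t_d(\tau))-\mathcal L_d^*}{\mathcal L_d(0)-\mathcal L_d^*}.$$ Then gradient descent has the following asymptotic convergence rate. 1. If $\alpha<1$, with $t_d(\tau)=\tfrac12\tau d^\alpha$, $$r(\tau)=\frac{1-\alpha}{\alpha}\,E_{1/\alpha}(\tau)\sim\frac{1-\alpha}{\alpha}\,\frac{e^{-\tau}}{\tau+1}\quad\text{ as }\tau\to\infty.$$ 2. If $\alpha=1$, with $t_d(\tau)=\tfrac12 d^{\tau}$ where $\tau\in[0,1]$, $$r(\tau)=1-\tau.$$ 3. If $\alpha>1$, with $t_d(\tau)=\tau$, as $\tau\to\infty$, $$r(\tau)\sim\frac{B\!\left(1-\frac1\alpha,\,1+2\tau\right)}{\alpha\,\zeta(\alpha)}\sim C\,\frac{1}{\tau^{1-\frac1\alpha}},\qquad C=\frac{\Gamma\!\left(1-\frac1\alpha\right)}{\alpha\,\zeta(\alpha)}.$$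
   Context: Linear bigram problem. Let $\mathbf X,\mathbf Y\in\{0,1\}^{n\times d}$ have one-hot rows, encoding $n$ pairs $(x_i,y_i)\in[d]\times[d]$. The loss is $\mathcal L_d(\mathbf W)=\frac1{2n}\|\mathbf X\mathbf W-\mathbf Y\|_F^2$ for $\mathbf W\in\mathbb R^{d\times d}$, with minimum $\mathcal L_d^*$. The frequencies are $\pi_k=\frac1n\sum_i \mathbf 1_{x_i=k}$ and $\pi_{k|j}=\frac{\sum_i\mathbf 1_{y_i=k}\mathbf 1_{x_i=j}}{\sum_i\mathbf 1_{x_i=j}}$ (with $0/0=0$). Power law with exponent $\alpha$: with $z=\sum_{k=1}^d k^{-\alpha}$, one has $\pi_k=\frac1{z k^\alpha}$ for all $k\in[d]$, and for every $j\in[d]$ there is a permutation $\rho_j$ of $[d]$ with $\pi_{\rho_j(k)|j}=\frac1{zk^\alpha}$ for all $k\in[d]$. The excess loss depends on the data only through the frequencies: $\mathcal L_d(\mathbf W)-\mathcal L_d^*=\frac12\sum_{i,j=1}^d\pi_i(W_{ij}-\pi_{j|i})^2$; this formula is used as the meaning of the excess loss for arbitrary real-valued frequencies satisfying the power law (whether or not they are realized by a finite dataset). Gradient descent with step-size $\eta$ from $0$ is $\mathbf W_{t+1}=\mathbf W_t-\eta\nabla\mathcal L_d(\mathbf W_t)$, so that after $t$ steps $W_{ij}-\pi_{j|i}=-(1-\eta\pi_i)^t\pi_{j|i}$; this closed form defines $\mathcal L_d(t)-\mathcal L_d^*$ for non-integer real $t\ge0$ as well (with $0^0=1$). Special functions: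 $\Gamma$ is the Gamma function, $B$ the Beta function, $\zeta$ the Riemann zeta function, and $E_p(\tau)=\tau^{p-1}\int_\tau^\infty z^{-p}e^{-z}\,dz$ the generalized exponential integral (for $\tau=0$ and $p>1$, $E_p(0)=\frac1{p-1}$). $f(\tau)\sim g(\tau)$ means $f/g\to1$.
   Formalization: In case 3 the last equivalence is proved with 1/(2τ)^{1−1/α} in place of 1/τ^{1−1/α}, with the same C, because B(1−1/α, 1+2τ) ~ Γ(1−1/α)(2τ)^{−(1−1/α)} makes the printed equivalence false by the factor 2^{1−1/α}. *)

(* Defs.v *)
From mathcomp Require Import all_boot all_order all_algebra all_fingroup.
From mathcomp Require Import ring lra.
From mathcomp Require Import all_classical all_reals all_analysis.

Set Implicit Arguments.
Unset Strict Implicit.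
Unset Printing Implicit Defensive.

Import Order.TTheory GRing.Theory Num.Theory.
Import numFieldNormedType.Exports.

Local Open Scope classical_set_scope.
Local Open Scope ring_scope.

(* Linear bigram problem with vocabulary ['I_d]: [p i] is the frequency of
   token [i], and [c i j] is the conditional frequency of [j] given [i].
   Token [k] in {1, ..., d} is the ordinal of value [k - 1]. *)
Section Bigram.
Context {R : realType} {d : nat}.
Implicit Types (p : 'I_d -> R) (c W : 'M[R]_d).

Definition power_law (alpha : R) p c : Prop :=
  let z := \sum_(k < d) k.+1%:R `^ (- alpha) in
  (forall k : 'I_d, p k = 1 / (z * k.+1%:R `^ alpha)) /\
  (forall j : 'I_d, exists rho : {perm 'I_d},
     forall k : 'I_d, c j (rho k) = 1 / (z * k.+1%:R `^ alpha)).

(* L_d(W) - L_d^*, expressed through the frequencies. *)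
Definition excess_loss p c W : R :=
  1 / 2 * \sum_(i < d) \sum_(j < d) p i * (W i j - c i j) ^+ 2.

(* L_d and L_d - L_d^* have the same gradient. *)
Definition loss_gradient p c W : 'M[R]_d :=
  \matrix_(i, j) derive1 (fun h : R => excess_loss p c (W + h *: delta_mx i j)) 0.

Definition gd_iterate p c (eta : R) (n : nat) : 'M[R]_d :=
  iter n (fun W => W - eta *: loss_gradient p c W) 0.

(* Gradient descent extended to real times; see [gd_iterateE].  With the
   step-size 1 / pi_1 all the bases [1 - eta * p i] lie in [0, 1[; note that
   [0 `^ 0 = 1], and [0 `^ t = 0] for [t != 0]. *)
Definition gd p c (eta t : R) : 'M[R]_d :=
  \matrix_(i, j) (c i j - (1 - eta * p i) `^ t * c i j).

Definition excess_loss_ratio p c (eta t : R) : R :=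
  excess_loss p c (gd p c eta t) / excess_loss p c (gd p c eta 0).

Lemma loss_gradientE p c W i j :
  loss_gradient p c W i j = p i * (W i j - c i j).
Proof.
rewrite mxE.
set g := fun h : R => _; set e := W i j - c i j.
have [a gE] : exists a, g = cst a + p i / 2 *: (cst e + id) ^+ 2.
  have splitE (h' : R) : \sum_(k < d) \sum_(l < d)
       p k * ((W + h' *: delta_mx i j) k l - c k l) ^+ 2
     = p i * ((W i j + h') - c i j) ^+ 2
       + (\sum_(l < d | l != j) p i * (W i l - c i l) ^+ 2
       + \sum_(k < d | k != i) \sum_(l < d) p k * (W k l - c k l) ^+ 2).
    rewrite (bigD1 i) //= (bigD1 j) //= !mxE !eqxx mulr1 [RHS]addrA.
    congr (_ + _ + _).
      by apply: eq_bigr => l /negPf lj; rewrite !mxE lj andbF mulr0 addr0.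
    apply: eq_bigr => k /negPf ki; apply: eq_bigr => l _.
    by rewrite !mxE ki mulr0 addr0.
  eexists; apply/funext => h; rewrite /g /excess_loss splitE mulrDr addrC.
  congr (_ + _).
  by rewrite !fctE /= /GRing.scale /= /e; field.
rewrite gE derive1E.
rewrite derive_val.
by rewrite !fctE /= /GRing.scale /=; field.
Qed.

Lemma gd_iterateE p c (eta : R) (n : nat) :
  (forall i, eta * p i <= 1) -> gd_iterate p c eta n = gd p c eta n%:R.
Proof.
move=> hp; apply/matrixP => i j; rewrite mxE powR_mulrn ?subr_ge0 //.
elim: n => [|n IH]; first by rewrite mxE expr0 mul1r subrr.
rewrite /gd_iterate iterS -/(gd_iterate p c eta n).
rewrite mxE [X in _ + X]mxE [X in - X]mxE loss_gradientE IH exprS.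
by ring.
Qed.

End Bigram.

Section Rate.
Context {R : realType}.

(* Vocabulary sizes d >= 1 are written [d.+1], so [ord0] is token 1 and the
   step-size is 1 / pi_1.  The time scaling [t] takes the vocabulary size as
   its first argument. *)
Definition rate_seq (p : forall d, 'I_d.+1 -> R) (c : forall d, 'M[R]_d.+1)
    (t : nat -> R -> R) (tau : R) : nat -> R :=
  fun d => excess_loss_ratio (p d) (c d) (1 / p d ord0) (t d.+1 tau).

Definition asymptotic_rate p c t (tau : R) : R := limn (rate_seq p c t tau).

Definition asymp_equiv (f g : R -> R) : Prop :=
  f tau / g tau @[tau --> +oo] --> (1 : R).

Definition Gamma (s : R) : R :=
  \int[lebesgue_measure]_(x in `]0, +oo[) (x `^ (s - 1) * expR (- x)).

Definition Beta (a b : R) : R :=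
  \int[lebesgue_measure]_(x in `]0, 1[) (x `^ (a - 1) * (1 - x) `^ (b - 1)).

Definition zeta (s : R) : R := limn (series (riemannR s)).

Definition expint (q tau : R) : R :=
  if tau == 0 then 1 / (q - 1)
  else tau `^ (q - 1) *
       \int[lebesgue_measure]_(x in `[tau, +oo[) (x `^ (- q) * expR (- x)).

End Rate.

(* Main.v *)
(* The ratio of excess losses after time t is the sum over k <= d of
   h_T (k^-alpha), where T = 2 t and h_T x = x (1 - x)^T, divided by the same
   sum for T = 0.  The function h_T is unimodal with maximum at most 1/(1 + T),
   so that the sum differs by at most 2/(1 + T) from the integral over u in
   [1, d] of h_T (u^-alpha).  Up to a power of N, for any scale N > 0, this
   integral is the integral of y^(-1/alpha) (1 - y/N)^T over ]N d^-alpha, N].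
   With N = T and dominated convergence it tends to an incomplete Gamma
   integral: this gives the exponential integral for alpha < 1 and
   Gamma (1 - 1/alpha) for alpha > 1, where N = 1 also gives the Beta function.
   For alpha = 1 the terms of the sum are compared with 1/(k + T), whose sums
   are logarithms up to bounded errors. *)
Require Import Defs.
From mathcomp Require Import all_boot all_order all_algebra all_fingroup.
From mathcomp Require Import ring lra.
From mathcomp Require Import all_classical all_reals all_analysis.
From mathcomp Require Import measurable_realfun.
Import Order.TTheory GRing.Theory Num.Theory.
Import numFieldNormedType.Exports.
Local Open Scope classical_set_scope.
Local Open Scope ring_scope.

(** * The profile [x (1 - x)^T] *)

Section ElementaryBounds.
Context {R : realType}.
Implicit Types (x y s t T a : R).

(** Concavity: [ln] lies below its tangent. Applied in both orders of the points it bounds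
    increments of [ln] from both sides, which replaces derivatives in the monotonicity of the
    profile and drives the logarithmic sums. *)
Lemma ln_frac_le x y : 0 < x -> 0 < y -> ln (y / x) <= (y - x) / x.
Proof.
move=> x0 y0; have -> : y / x = 1 + (y - x) / x by field; lra.
apply: le_ln1Dx.
have -> : (y - x) / x = y / x - 1 by field; lra.
by have := divr_gt0 y0 x0; lra.
Qed.

Lemma powR_onem_le_expR T x : 0 <= T -> 0 <= x <= 1 ->
  (1 - x) `^ T <= expR (- (T * x)).
Proof.
move=> T0 /andP[x0 x1].
have -> : - (T * x) = - x * T by ring.
rewrite expRM; apply: ge0_ler_powR => //; rewrite ?nnegrE ?subr_ge0 ?expR_ge0//.
by have := expR_ge1Dx (- x).
Qed.

(** Since 1 / (1 - x) = 1 + x / (1 - x) <= exp (x / (1 - x)), inverting and raising to the power [T]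
    gives the bound. *)
Lemma expR_le_powR_onem T x : 0 <= T -> 0 <= x < 1 ->
  expR (- (T * (x / (1 - x)))) <= (1 - x) `^ T.
Proof.
move=> T0 /andP[x0 x1].
have -> : - (T * (x / (1 - x))) = - (x / (1 - x)) * T by ring.
rewrite expRM; apply: ge0_ler_powR => //; rewrite ?nnegrE ?expR_ge0//.
  by lra.
rewrite expRN -[leRHS]invrK lef_pV2 ?posrE ?expR_gt0 ?invr_gt0; [|lra..].
apply: le_trans (expR_ge1Dx _).
by rewrite le_eqVlt; apply/orP; left; apply/eqP; field; lra.
Qed.

Lemma expRN_le_inv1D x : 0 <= x -> expR (- x) <= (1 + x)^-1.
Proof.
move=> x0; rewrite expRN lef_pV2 ?posrE ?expR_gt0//; last lra.
exact: expR_ge1Dx.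
Qed.

Definition gd_profile T x : R := x * (1 - x) `^ T.

Lemma gd_profile0 T : gd_profile T 0 = 0.
Proof. by rewrite /gd_profile mul0r. Qed.

Lemma gd_profile_ge0 T x : 0 <= x -> 0 <= gd_profile T x.
Proof. by move=> x0; rewrite mulr_ge0 ?powR_ge0. Qed.

(** (1 - x)^T <= exp (- T x) <= 1 / (1 + T x), and x (1 + T) <= 1 + T x because x <= 1. *)
Lemma gd_profile_le T x : 0 <= T -> 0 <= x <= 1 ->
  gd_profile T x <= (1 + T)^-1.
Proof.
move=> T0 /andP[x0 x1].
have Tx : 0 <= T * x by exact: mulr_ge0.
apply: (@le_trans _ _ (x * (1 + T * x)^-1)).
  apply: ler_wpM2l => //.
  apply: (le_trans (powR_onem_le_expR T x T0 _)); first by rewrite x0.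
  exact: expRN_le_inv1D.
rewrite ler_pdivrMr; last lra.
rewrite mulrC ler_pdivlMr; last lra.
nra.
Qed.

(** In logarithms, ln x gains at least (y - x) / y while T ln (1 - x) loses at most T (y - x) / (1 -
    y). The loss is the smaller one exactly when y (1 + T) <= 1. *)
Lemma gd_profile_nondecreasing T x y : 0 <= T ->
  0 <= x -> x <= y -> y <= (1 + T)^-1 -> gd_profile T x <= gd_profile T y.
Proof.
move=> T0; rewrite le_eqVlt => /predU1P[<- xy _|x0].
  by rewrite gd_profile0 gd_profile_ge0.
move=> xy yT; have y0 : 0 < y by lra.
have yT1 : y * (1 + T) <= 1 by rewrite -ler_pdivlMr ?div1r//; lra.
(* For [T = 0] the profile is the identity, and [y] may equal 1, where the logarithm of [1 - y] is
   out of reach. *)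
have := T0; rewrite le_eqVlt => /predU1P[<-|Tgt0].
  by rewrite /gd_profile !powRr0 !mulr1.
have y1 : y < 1 by nra.
rewrite /gd_profile.
have hx : 0 < 1 - x by lra.
have hy : 0 < 1 - y by lra.
rewrite -ler_ln ?posrE ?mulr_gt0 ?powR_gt0// !lnM ?posrE ?powR_gt0// !ln_powR.
have := ln_frac_le y x y0 x0; rewrite ln_div ?posrE// => h1.
have := ln_frac_le (1 - y) (1 - x) hy hx; rewrite ln_div ?posrE// => h2.
have h3 : T * ((1 - x - (1 - y)) / (1 - y)) <= (y - x) / y.
  rewrite mulrA ler_pdivrMr// mulrAC ler_pdivlMr//.
  have -> : 1 - x - (1 - y) = y - x by ring.
  have := mulr_ge0 (_ : 0 <= y - x) (_ : 0 <= 1 - y * (1 + T)).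
  rewrite subr_ge0 subr_ge0 => /(_ xy yT1); lra.
have h4 := ler_wpM2l T0 h2.
have h5 : (y - x) / y = - ((x - y) / y) by field; lra.
lra.
Qed.

(** Same comparison of logarithms, with the tangents now taken at [x] and [1 - x]. *)
Lemma gd_profile_nonincreasing T x y : 0 <= T ->
  (1 + T)^-1 <= x -> x <= y -> y <= 1 -> gd_profile T y <= gd_profile T x.
Proof.
move=> T0 xT xy y1.
have x0 : 0 < x by apply: lt_le_trans xT; rewrite invr_gt0; lra.
have xT1 : 1 <= x * (1 + T) by rewrite -ler_pdivrMr ?div1r//; lra.
have := T0; rewrite le_eqVlt => /predU1P[T00|Tgt0].
  by rewrite /gd_profile -T00 !powRr0 !mulr1; rewrite -T00 in xT1; lra.
(* At [y = 1] the logarithm is out of reach, but the profile vanishes since [T] is positive. *)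
have := y1; rewrite le_eqVlt => /predU1P[->|{}y1].
  rewrite /gd_profile subrr powR0 ?gt_eqF// mulr0.
  by rewrite mulr_ge0 ?powR_ge0// ltW.
have y0 : 0 < y by lra.
rewrite /gd_profile.
have hx : 0 < 1 - x by lra.
have hy : 0 < 1 - y by lra.
rewrite -ler_ln ?posrE ?mulr_gt0 ?powR_gt0// !lnM ?posrE ?powR_gt0// !ln_powR.
have := ln_frac_le x y x0 y0; rewrite ln_div ?posrE// => h1.
have := ln_frac_le (1 - x) (1 - y) hx hy; rewrite ln_div ?posrE// => h2.
have h3 : (y - x) / x <= T * ((y - x) / (1 - x)).
  rewrite mulrA ler_pdivlMr// mulrAC ler_pdivrMr//.
  have := mulr_ge0 (_ : 0 <= y - x) (_ : 0 <= x * (1 + T) - 1).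
  rewrite subr_ge0 subr_ge0 => /(_ xy xT1); lra.
have h4 := ler_wpM2l T0 h2.
have h5 : T * ((1 - y - (1 - x)) / (1 - x)) = - (T * ((y - x) / (1 - x))).
  by field; lra.
lra.
Qed.

(* [v] is the variation function of the unimodal [gd_profile T]; its total
   increase is at most twice the maximum of [gd_profile T]. *)
Lemma gd_profile_variation T : 0 <= T -> exists v : R -> R,
  [/\ forall x y, 0 <= x -> x <= y -> y <= 1 ->
        `|gd_profile T y - gd_profile T x| <= v y - v x,
      0 <= v 0 & v 1 <= 2 / (1 + T)].
Proof.
move=> T0; set m := (1 + T)^-1.
have m0 : 0 <= m by rewrite invr_ge0; lra.
have m1 : m <= 1 by rewrite invf_le1; lra.
set g := gd_profile T.
exists (fun x => if x <= m then g x else 2 * g m - g x); split.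
- move=> x y x0 xy y1.
  have [xm|mx] := leP x m; have [ym|my] := leP y m.
  + by rewrite ger0_norm// subr_ge0; exact: gd_profile_nondecreasing.
  + have h1 : g x <= g m by exact: gd_profile_nondecreasing.
    have h2 : g y <= g m by apply: gd_profile_nonincreasing => //; exact: ltW.
    by rewrite ler_norml; apply/andP; split; lra.
  + by move: (lt_le_trans mx (le_trans xy ym)); rewrite ltxx.
  + have h : g y <= g x by apply: gd_profile_nonincreasing => //; exact: ltW.
    by rewrite ler0_norm; lra.
- by rewrite m0 /g gd_profile0.
- have gm : g m <= m by by apply: gd_profile_le => //; rewrite m0.
  have g1 : 0 <= g 1 by exact: gd_profile_ge0.
  (* The case [1 <= m] occurs only for [T = 0], when the profile increases on all of [0, 1]. *)
  by case: ifPn => h; [have := gd_profile_le T 1 T0|]; rewrite -/m -/g; lra.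
Qed.

End ElementaryBounds.

(** * Reduction of the loss ratio to sums of the profile *)

Section ExcessLossRatio.
Context {R : realType}.

Lemma sum_powR_gt0 (alpha : R) (d : nat) :
  0 < \sum_(k < d.+1) k.+1%:R `^ (- alpha) :> R.
Proof.
rewrite big_ord_recl; apply: ltr_pwDl; first exact: powR_gt0.
by apply: sumr_ge0 => i _; exact: powR_ge0.
Qed.

(** All rows of [c] are permutations of one vector, so they share the sum of squares [S], which
    cancels. The step-size turns p i into i^(-alpha), and squaring the residual factor doubles the
    time. *)
Lemma excess_loss_ratioE (alpha : R) (d : nat) (p : 'I_d.+1 -> R)
    (c : 'M[R]_d.+1) (t : R) : power_law alpha p c ->
  excess_loss_ratio p c (1 / p ord0) t =
  (\sum_(k < d.+1) gd_profile (2 * t) (k.+1%:R `^ (- alpha))) /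
  (\sum_(k < d.+1) k.+1%:R `^ (- alpha)).
Proof.
move=> [pE cE]; set z := \sum_(k < d.+1) _ in pE cE *.
have z0 : 0 < z by exact: sum_powR_gt0.
pose S := \sum_(k < d.+1) (1 / (z * k.+1%:R `^ alpha)) ^+ 2.
have rowS i : \sum_(j < d.+1) c i j ^+ 2 = S.
  have [rho rhoE] := cE i.
  rewrite (reindex_inj (@perm_inj _ rho)) /=.
  by apply: eq_bigr => k _; rewrite rhoE.
have S0 : 0 < S.
  rewrite /S big_ord_recl; apply: ltr_pwDl.
    by rewrite exprn_gt0// divr_gt0// mulr_gt0// powR_gt0.
  by apply: sumr_ge0 => i _; rewrite sqr_ge0.
have pE' i : p i = i.+1%:R `^ (- alpha) / z.
  by rewrite pE powRN div1r invfM mulrC.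
have step i : 1 / p ord0 * p i = i.+1%:R `^ (- alpha).
  rewrite !pE' powR1; field; lra.
have lossE s : excess_loss p c (gd p c (1 / p ord0) s) =
    S / (2 * z) * \sum_(k < d.+1) gd_profile (2 * s) (k.+1%:R `^ (- alpha)).
  rewrite /excess_loss; transitivity
    (1 / 2 * \sum_(i < d.+1) S / z * gd_profile (2 * s) (i.+1%:R `^ (- alpha))).
    congr (_ * _); apply: eq_bigr => i _.
    under eq_bigr => j _ do rewrite mxE step.
    rewrite /gd_profile mulrC.
    have -> : (1 - i.+1%:R `^ (- alpha)) `^ (2 * s) =
        ((1 - i.+1%:R `^ (- alpha)) `^ s) ^+ 2.
      by rewrite mulrC powRrM powR_mulrn// powR_ge0.
    transitivity (p i * ((1 - i.+1%:R `^ (- alpha)) `^ s) ^+ 2 *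
                  \sum_(j < d.+1) c i j ^+ 2).
      by rewrite mulr_sumr mulrC; apply: eq_bigr => j _; ring.
    by rewrite rowS pE'; ring.
  rewrite -mulr_sumr mulrA; congr (_ * _); field; lra.
rewrite /excess_loss_ratio !lossE.
(* The convention 0^0 = 1 matters: the base of token 1 is 0, and its term has to count in the
   initial loss. *)
have -> : \sum_(k < d.+1) gd_profile (2 * 0) (k.+1%:R `^ (- alpha)) = z.
  by apply: eq_bigr => k _; rewrite /gd_profile mulr0 powRr0 mulr1.
by field; rewrite !gt_eqF.
Qed.

End ExcessLossRatio.

(** * Comparison of the sum with an integral *)

Section PowerIntegrals.
Context {R : realType}.
Notation mu := (@lebesgue_measure R).
Implicit Types (a b x y q T N p : R).

Lemma continuous_powR_itv p a b : 0 < a ->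
  {within `[a, b], continuous (@powR R ^~ p : R -> R)}.
Proof.
move=> a0; apply: derivable_within_continuous => x.
rewrite in_itv/= => /andP[ax _].
by apply: derivable_powR; rewrite in_itv/= andbT; exact: lt_le_trans ax.
Qed.

Lemma integrable_powR_itv p a b : 0 < a ->
  mu.-integrable `]a, b] (EFin \o @powR R ^~ p).
Proof.
move=> a0.
have : mu.-integrable `[a, b] (EFin \o @powR R ^~ p).
  apply: continuous_compact_integrable; first exact: segment_compact.
  exact: continuous_powR_itv.
by apply: integrableS => //; exact: subset_itv_oc_cc.
Qed.

Lemma Rintegral_powR p a b : 0 < a -> a < b -> p + 1 != 0 ->
  \int[mu]_(x in `]a, b]) x `^ p = (b `^ (p + 1) - a `^ (p + 1)) / (p + 1).
Proof.
move=> a0 ab p0.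
rewrite Rintegral_itv_obnd_cbnd; last exact: integrable_powR_itv.
pose F x := (p + 1)^-1 * x `^ (p + 1).
have dF x : 0 < x -> is_derive x 1 F (x `^ p).
  move=> x0.
  have dp := is_derive1_powR (p + 1) x0.
  have := @is_deriveZ _ _ _ (@powR R ^~ (p + 1)) (p + 1)^-1 x 1 _ dp.
  by rewrite /GRing.scale/= addrK mulrA mulVf// mul1r.
have cF x : 0 < x -> F z @[z --> x] --> F x.
  move=> x0; apply: differentiable_continuous; apply/derivable1_diffP.
  by apply: ex_derive; exact: dF.
rewrite /Rintegral (@continuous_FTC2 _ (@powR R ^~ p) F)//=.
- by rewrite /F; ring.
- exact: continuous_powR_itv.
- split.
  + move=> x; rewrite in_itv/= => /andP[ax _].
    by apply: ex_derive; apply: dF; exact: lt_trans ax.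
  + by apply: cvg_at_right_filter; exact: cF.
  + by apply: cvg_at_left_filter; apply: cF; exact: lt_trans ab.
- move=> x; rewrite in_itv/= => /andP[ax _].
  have dFx := dF x (lt_trans a0 ax).
  by rewrite derive1E derive_val.
Qed.

(** The intervals [F i] exhaust ]0, b] and avoid the singularity. The explicit integrals over them
    are at most b^(1 - q) / (1 - q), and monotone convergence carries the bound over. *)
Lemma integrable_powR_itv0 q b : 0 < q < 1 ->
  mu.-integrable `]0, b] (EFin \o @powR R ^~ (- q)).
Proof.
move=> /andP[q0 q1].
have [b0|b0] := leP b 0.
  by rewrite set_itv_ge; [exact: integrable_set0|rewrite bnd_simp -leNgt].
have f0 x : (0 <= (x `^ (- q))%:E)%E by rewrite lee_fin powR_ge0.
apply/integrableP; split; first exact/measurable_EFinP/measurable_funTS.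
under eq_integral => x _ do rewrite /= ger0_norm ?powR_ge0//.
pose F i : set R := `](b / i.+1%:R), b]%classic.
have -> : `]0, b]%classic = \bigcup_i F i.
  apply/seteqP; split => [x|x [i _]]; rewrite /F /= !in_itv/=.
    move=> /andP[x0 xb]; exists (Num.truncn (b / x)) => //=.
    rewrite in_itv/= xb andbT ltr_pdivrMr// mulrC -ltr_pdivrMr//.
    exact: truncnS_gt.
  by move=> /andP[+ ->]; rewrite andbT; apply: lt_trans; rewrite divr_gt0.
have bnd i : (\int[mu]_(x in F i) (x `^ (- q))%:E <=
    (b `^ (1 - q) / (1 - q))%:E)%E.
  rewrite /F; case: i => [|i].
    rewrite divr1 set_itv_ge ?bnd_simp ?ltxx// integral_set0 lee_fin.
    by rewrite divr_ge0 ?powR_ge0 ?subr_ge0// ltW.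
  have bi : 0 < b / i.+2%:R by rewrite divr_gt0.
  have bib : b / i.+2%:R < b by rewrite ltr_pdivrMr// ltr_pMr// ltr1n.
  rewrite -[leLHS]fineK; last first.
    by apply: integrable_fin_num => //; exact: integrable_powR_itv.
  rewrite lee_fin -/(Rintegral mu `](b / i.+2%:R), b] (@powR R ^~ (- q))).
  rewrite Rintegral_powR//; last by rewrite addrC subr_eq0 gt_eqF.
  rewrite [- q + 1]addrC ler_pM2r ?invr_gt0 ?subr_gt0// lerBlDr lerDl.
  exact: powR_ge0.
have nd : nondecreasing_seq F.
  move=> m n mn; rewrite subsetEset => x; rewrite /F /= !in_itv/=.
  move=> /andP[+ ->]; rewrite andbT; apply: le_lt_trans.
  by rewrite ler_pM2l// lef_pV2 ?posrE// ler_nat ltnS.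
have cvF : (\int[mu]_(x in F i) (x `^ (- q))%:E @[i --> \oo] -->
    \int[mu]_(x in \bigcup_i F i) (x `^ (- q))%:E)%E.
  apply: ge0_nondecreasing_set_cvg_integral => //.
    by move=> i; exact: measurable_itv.
  by move=> i; exact/measurable_EFinP/measurable_funTS.
apply: (@le_lt_trans _ _ (b `^ (1 - q) / (1 - q))%:E); last exact: ltry.
by apply: (cvge_le _ cvF); apply: nearW => n; exact: bnd.
Qed.

End PowerIntegrals.

(** * The sum against the substituted integral, block by block *)

Section SumIntegralComparison.
Context {R : realType}.
Notation mu := (@lebesgue_measure R).
Implicit Types (a b x y q T N p : R).

(** What h_T (u^(-alpha)) du becomes, up to the factor q N^(q - 1), under y = N u^(-alpha) with q =
    1 / alpha. *)
Definition gd_integrand q T N y : R := y `^ (- q) * (1 - y / N) `^ T.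

Lemma measurable_gd_integrand q T N (D : set R) :
  measurable_fun D (gd_integrand q T N).
Proof.
apply: measurable_funTS; apply: measurable_funM => //.
apply: (measurableT_comp (measurable_powR T)).
by apply: measurable_funB => //; exact: measurable_funM.
Qed.

Lemma gd_integrand_bounds q T N y : 0 <= T -> 0 < N -> 0 < y <= N ->
  0 <= gd_integrand q T N y <= y `^ (- q).
Proof.
move=> T0 N0 /andP[y0 yN]; rewrite mulr_ge0 ?powR_ge0//=.
rewrite ler_piMr ?powR_ge0//.
have y1 : 0 <= y / N <= 1.
  by rewrite ler_pdivrMr// mul1r yN andbT divr_ge0// ltW.
have := powR_onem_le_expR T _ T0 y1; move/le_trans; apply.
by rewrite expR_le1 oppr_le0 mulr_ge0//; case/andP: y1.
Qed.

Lemma integrable_gd_integrand q T N (D : set R) : 0 <= T -> 0 < N ->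
    measurable D -> D `<=` `]0, N] ->
    mu.-integrable D (EFin \o @powR R ^~ (- q)) ->
  mu.-integrable D (EFin \o gd_integrand q T N).
Proof.
move=> T0 N0 mD DN; apply: le_integrable => //.
  by apply/measurable_EFinP; exact: measurable_gd_integrand.
move=> x /DN /=; rewrite in_itv/= => /gd_integrand_bounds.
move=> /(_ q T T0 N0) /andP[h0 h1].
by rewrite lee_fin !ger0_norm ?powR_ge0.
Qed.

(** The integrand is N times the profile at s / N times the weight s^(-q - 1). With the prefactors
    this weight has total mass x^(-q) - y^(-q), so the integral averages the profile over [x, y] and
    differs from its value at [y] by at most [V] per unit of mass. *)
Lemma gd_integrand_itv_approx q T N x y (V : R) :
    0 < q -> 0 <= T -> 0 < N -> 0 < x -> x < y -> y <= 1 ->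
    (forall z, x <= z <= y -> `|gd_profile T y - gd_profile T z| <= V) ->
  `|gd_profile T y * (x `^ (- q) - y `^ (- q)) -
    q * N `^ (q - 1) * \int[mu]_(s in `](N * x), (N * y)]) gd_integrand q T N s|
  <= V * (x `^ (- q) - y `^ (- q)).
Proof.
move=> q0 T0 N0 x0 xy y1 hV.
have y0 : 0 < y by exact: lt_trans xy.
have Nx0 : 0 < N * x by exact: mulr_gt0.
have Nxy : N * x < N * y by rewrite ltr_pM2l.
set I := `](N * x), (N * y)]%classic.
have mI : measurable I by exact: measurable_itv.
pose w s : R := s `^ (- q - 1).
set J := \int[mu]_(s in I) w s.
have iw : mu.-integrable I (EFin \o w) by exact: integrable_powR_itv.
have JE : q * N `^ (q - 1) * N * J = x `^ (- q) - y `^ (- q).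
  rewrite /J Rintegral_powR//; last by rewrite subrK oppr_eq0 gt_eqF.
  rewrite subrK !powRM ?ltW// -mulrBr.
  have NN : N `^ (q - 1) * N * N `^ (- q) = 1.
    rewrite -[X in _ * X * _]powRr1 ?ltW// -!powRD ?(gt_eqF N0) ?implybT//.
    by rewrite subrK subrr powRr0.
  transitivity ((N `^ (q - 1) * N * N `^ (- q)) * (x `^ (- q) - y `^ (- q))).
    by field; lra.
  by rewrite NN mul1r.
have K0 : 0 <= q * N `^ (q - 1) by rewrite mulr_ge0 ?powR_ge0 ?ltW.
have fE s : 0 < s -> gd_integrand q T N s = N * gd_profile T (s / N) * w s.
  move=> s0; rewrite /gd_integrand /gd_profile /w powRD; last first.
    by rewrite (gt_eqF s0) implybT.
  by rewrite powR_inv1 ?ltW//; field; lra.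
have sI s : I s -> 0 < s /\ x <= s / N <= y.
  rewrite /I/= in_itv/= => /andP[h1 h2]; split; first exact: lt_trans h1.
  by rewrite ler_pdivlMr// ler_pdivrMr// ![_ * N]mulrC (ltW h1).
have if_ : mu.-integrable I (EFin \o gd_integrand q T N).
  apply: integrable_gd_integrand => //; last exact: integrable_powR_itv.
  move=> s; rewrite /I/= !in_itv/= => /andP[h1 h2].
  rewrite (lt_trans _ h1)//= (le_trans h2)// ler_piMr//; exact: ltW.
have iwc k : mu.-integrable I (EFin \o (fun s => k * w s)).
  by apply: eq_integrable (integrableZl _ k iw).
set h := gd_profile T y in hV *.
have up : \int[mu]_(s in I) gd_integrand q T N s <= N * (h + V) * J.
  rewrite /J -RintegralZl//; apply: le_Rintegral => //.
  move=> s /sI[s0 sxy]; rewrite fE// ler_wpM2r ?powR_ge0// ler_pM2l//.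
  by have := hV _ sxy; rewrite ler_norml; lra.
have lo : N * (h - V) * J <= \int[mu]_(s in I) gd_integrand q T N s.
  rewrite /J -RintegralZl//; apply: le_Rintegral => //.
  move=> s /sI[s0 sxy]; rewrite fE// ler_wpM2r ?powR_ge0// ler_pM2l//.
  by have := hV _ sxy; rewrite ler_norml; lra.
have {}up := ler_wpM2l K0 up; have {}lo := ler_wpM2l K0 lo.
have upE : q * N `^ (q - 1) * (N * (h + V) * J) =
    (h + V) * (x `^ (- q) - y `^ (- q)) by rewrite -JE; ring.
have loE : q * N `^ (q - 1) * (N * (h - V) * J) =
    (h - V) * (x `^ (- q) - y `^ (- q)) by rewrite -JE; ring.
by rewrite ler_norml; apply/andP; split; lra.
Qed.

(* The scale [N] is free: [N = 1] gives incomplete Beta integrals and [N = T]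
   gives approximations of incomplete Gamma integrals, so that no change of
   variables is needed to relate them. *)
Lemma sum_gd_profile_approx alpha T N (n : nat) :
    0 < alpha -> 0 <= T -> 0 < N ->
  `|\sum_(k < n) gd_profile T (k.+1%:R `^ (- alpha)) -
    alpha^-1 * N `^ (alpha^-1 - 1) *
    \int[mu]_(s in `](N * n.+1%:R `^ (- alpha)), N])
      gd_integrand alpha^-1 T N s| <= 2 / (1 + T).
Proof.
move=> a0 T0 N0; set q := alpha^-1; have q0 : 0 < q by rewrite invr_gt0.
have [v [vvar v0 v1]] := gd_profile_variation T T0.
pose x (k : nat) : R := k.+1%:R `^ (- alpha).
have x_gt0 k : 0 < x k by exact: powR_gt0.
have xS k : x k.+1 < x k.
  rewrite /x !powRN ltf_pV2 ?posrE ?powR_gt0//.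
  by rewrite gt0_ltr_powR ?nnegrE// ltr_nat.
have x0E : x 0%N = 1 by rewrite /x powR1.
have x_le1 k : x k <= 1.
  by elim: k => [|k IH]; [rewrite x0E|exact: le_trans (ltW (xS k)) IH].
have xq k : x k `^ (- q) = k.+1%:R.
  by rewrite /x -powRrM mulrNN divff ?gt_eqF// powRr1.
(* This sharper bound suits the induction: the block between [x n.+1] and [x n] costs the increment
   of [v] there, and the increments telescope. *)
suff H : `|\sum_(k < n) gd_profile T (x k) - q * N `^ (q - 1) *
    \int[mu]_(s in `](N * x n), N]) gd_integrand q T N s| <= v 1 - v (x n).
  apply: (le_trans H).
  have := vvar 0 (x n) (lexx 0) (ltW (x_gt0 n)) (x_le1 n).
  by have := normr_ge0 (gd_profile T (x n) - gd_profile T 0); lra.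
elim: n => [|n IH].
  rewrite big_ord0 x0E mulr1 set_itv_ge ?bnd_simp ?ltxx//.
  by rewrite Rintegral_set0 mulr0 subr0 normr0 subrr.
rewrite big_ord_recr/=.
have Nx k : N * x k <= N by rewrite ler_piMr// ltW.
have iN : mu.-integrable `](N * x n.+1), N] (EFin \o gd_integrand q T N).
  apply: integrable_gd_integrand => //.
    by apply: subset_itvr; rewrite bnd_simp mulr_ge0// ltW.
  by apply: integrable_powR_itv; exact: mulr_gt0.
have := @Rintegral_itvB _ _ _ _ (N * x n) iN.
rewrite !bnd_simp ler_pM2l// => /(_ (ltW (xS n)) (Nx n)) splitE.
have := @gd_integrand_itv_approx q T N (x n.+1) (x n) (v (x n) - v (x n.+1))
  q0 T0 N0 (x_gt0 _) (xS n) (x_le1 n).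
have vle z : x n.+1 <= z <= x n ->
    `|gd_profile T (x n) - gd_profile T z| <= v (x n) - v (x n.+1).
  move=> /andP[xz zx]; have x1 := ltW (x_gt0 n.+1).
  have := vvar z (x n) (le_trans x1 xz) zx (x_le1 n).
  have := vvar (x n.+1) z x1 xz (le_trans zx (x_le1 n)).
  move=> /(le_trans (normr_ge0 _)) h1 h2; apply: (le_trans h2).
  by rewrite lerD2l lerN2 -subr_ge0.
(* By [xq] the block has mass (n + 2) - (n + 1) = 1, so it matches exactly one term of the sum. *)
move=> /(_ vle); rewrite !xq -[n.+2%:R]natr1 addrAC subrr add0r !mulr1 => blk.
move/eqP: splitE; rewrite subr_eq => /eqP ->; rewrite mulrDr.
have -> : v 1 - v (x n.+1) = (v 1 - v (x n)) + (v (x n) - v (x n.+1)) by ring.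
apply: le_trans (lerD IH blk); apply: le_trans (ler_normD _ _).
rewrite le_eqVlt; apply/orP; left; apply/eqP; congr (`|_|).
by rewrite opprD addrACA.
Qed.

End SumIntegralComparison.

(** * Limits of the integrals *)

Lemma Rintegral_dominated_cvg d (T : measurableType d) (R : realType)
    (mu : {measure set T -> \bar R}) (D : set T)
    (f_ : nat -> T -> R) (f g : T -> R) :
    measurable D -> (forall n, measurable_fun D (f_ n)) ->
    (forall x, D x -> f_ ^~ x @ \oo --> f x) ->
    mu.-integrable D (EFin \o g) ->
    (forall n x, D x -> `|f_ n x| <= g x) ->
  \int[mu]_(x in D) f_ n x @[n --> \oo] --> \int[mu]_(x in D) f x.
Proof.
move=> mD mf_ cvf ig fg.
have mfE n : measurable_fun D (EFin \o f_ n) by exact/measurable_EFinP.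
have cvE : forall x, D x -> (EFin \o f_ n) x @[n --> \oo] --> (EFin \o f) x.
  by move=> x Dx; apply: cvg_EFin; [exact: nearW|exact: cvf].
have fgE n x : D x -> (`|(EFin \o f_ n) x| <= (EFin \o g) x)%E.
  by move=> Dx; rewrite lee_fin; exact: fg.
have gfin x : D x -> (EFin \o g) x \is a fin_num by [].
have mF : measurable_fun D (EFin \o f).
  by apply/measurable_EFinP; exact: measurable_fun_cvg mf_ cvf.
apply: fine_cvg; rewrite fineK.
  by apply: (dominated_cvg _ mfE cvE gfin ig fgE).
(* The limit is integrable because the bound by [g] passes to it pointwise. *)
apply: integrable_fin_num => //; apply: le_integrable ig => //.
move=> x Dx; rewrite /= lee_fin (le_trans _ (ler_norm _))//.
apply: (@ler_cvg_to _ \oo _ _ (fun n => `|f_ n x|) (cst (g x))).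
- exact: cvg_norm (cvf x Dx).
- exact: cvg_cst.
- by apply: nearW => n; exact: fg.
Qed.

(** * The exponential limit and the incomplete Gamma integral *)

Section GammaLimits.
Context {R : realType}.
Notation mu := (@lebesgue_measure R).
Implicit Types (a b x y s q N p : R).

(** Squeeze between exp (- y / (1 - y / T)) and exp (- y), the two exponential bounds at x = y /
    T. *)
Lemma cvg_powR_onem (T : nat -> R) y : 0 <= y -> T n @[n --> \oo] --> +oo ->
  (1 - y / T n) `^ T n @[n --> \oo] --> expR (- y).
Proof.
move=> y0 Ty.
have T0 : \forall n \near \oo, 0 < T n by exact: (cvgryPgt _).1 Ty _.
have Tv : (T n)^-1 @[n --> \oo] --> 0.
  exact: (gtr0_cvgV0 T0).2 Ty.
have yT : y / T n @[n --> \oo] --> 0.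
  by rewrite -[X in _ --> X](mulr0 y); exact: cvgMl_tmp.
have Tyn : \forall n \near \oo, y < T n by exact: (cvgryPgt _).1 Ty _.
apply: (@squeeze_cvgr _ _ _ _ (fun n => expR (- (y / (1 - y / T n))))
  (cst (expR (- y)))); last 2 first.
- have -> : expR (- y) = expR (- (y / (1 - 0))) by rewrite subr0 divr1.
  apply: (cvg_comp (fun n => - (y / (1 - y / T n))) expR); last first.
    exact: continuous_expR.
  apply: cvgN; apply: cvgMl_tmp; apply: cvgV; first by rewrite subr0 oner_neq0.
  by apply: cvgB => //; exact: cvg_cst.
- exact: cvg_cst.
near=> n.
have Tn0 : 0 < T n by near: n.
have yTn : y < T n by near: n.
have yT01 : 0 <= y / T n < 1.
  by rewrite ltr_pdivrMr// mul1r yTn andbT divr_ge0// ltW.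
have h1 := expR_le_powR_onem (T n) (y / T n) (ltW Tn0) yT01.
have yT01' : 0 <= y / T n <= 1 by case/andP: yT01 => -> /ltW ->.
have h2 := powR_onem_le_expR (T n) (y / T n) (ltW Tn0) yT01'.
rewrite /cst.
have e1 : T n * (y / T n / (1 - y / T n)) = y / (1 - y / T n).
  by rewrite !mulrA [T n * y]mulrC mulfK ?gt_eqF.
have e2 : T n * (y / T n) = y by rewrite mulrC divfK ?gt_eqF.
by rewrite -e1 h1/= (le_trans h2)// e2.
Unshelve. all: by end_near. Qed.

(** The common integrand of [Gamma (1 - q)] and [expint q]. *)
Definition gamma_integrand q y : R := y `^ (- q) * expR (- y).

Lemma measurable_gamma_integrand q (D : set R) :
  measurable_fun D (gamma_integrand q).
Proof.
apply: measurable_funTS; apply: measurable_funM => //.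
by apply: measurableT_comp => //; exact: measurable_funN.
Qed.

Lemma gamma_integrand_ge0 q y : 0 <= gamma_integrand q y.
Proof. by rewrite mulr_ge0 ?powR_ge0 ?expR_ge0. Qed.

Lemma is_derive_gamma_integrand q y : 0 < y ->
  is_derive y 1 (gamma_integrand q)
    (- (gamma_integrand q y + q * gamma_integrand (q + 1) y)).
Proof.
move=> y0; have d1 := is_derive1_powR (- q) y0.
have d2 := is_derive1_comp (is_derive_expR (- y))
  (is_deriveN (is_derive_id y 1)).
apply: is_derive_eq (is_deriveM d1 d2) _.
rewrite /gamma_integrand /GRing.scale/= [- (q + 1)]opprD.
by move: (y `^ _) (y `^ _) (expR _) => u w v; ring.
Qed.

Lemma gamma_integrandS q y : 0 < y ->
  gamma_integrand (q + 1) y = gamma_integrand q y / y.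
Proof.
move=> y0; rewrite /gamma_integrand opprD powRB ?(gt_eqF y0) ?implybT//.
by rewrite powRr1 ?ltW// mulrAC.
Qed.

(** Minus the derivative of g = [gamma_integrand q] is g(y) (1 + q / y), whose integral over [s,
    +oo[ is therefore g(s). There 1 <= 1 + q / y <= 1 + q / s, which gives integrability and both
    inequalities. *)
Lemma gamma_tail q s : 0 <= q -> 0 < s ->
  mu.-integrable `[s, +oo[ (EFin \o gamma_integrand q) /\
  let I := \int[mu]_(y in `[s, +oo[) gamma_integrand q y in
  I <= gamma_integrand q s <= (1 + q / s) * I.
Proof.
move=> q0 s0.
pose f y := gamma_integrand q y + q * gamma_integrand (q + 1) y.
have fE y : 0 < y -> f y = gamma_integrand q y * (1 + q / y).
  by move=> y0; rewrite /f gamma_integrandS//; ring.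
pose F y := - gamma_integrand q y.
have dF y : 0 < y -> is_derive y 1 F (f y).
  move=> y0; have := is_deriveN (is_derive_gamma_integrand q y y0).
  by rewrite opprK.
have cF y : 0 < y -> F z @[z --> y] --> F y.
  move=> y0; apply: differentiable_continuous; apply/derivable1_diffP.
  by apply: ex_derive; exact: dF.
have f0 y : 0 <= f y.
  by apply: addr_ge0; [|apply: mulr_ge0 => //]; exact: gamma_integrand_ge0.
have cf : {within `[s, +oo[, continuous f}.
  apply: derivable_within_continuous => y; rewrite in_itv/= andbT => sy.
  have y0 : 0 < y by exact: lt_le_trans sy.
  have dq := is_derive_gamma_integrand q y y0.
  have dqS := is_derive_gamma_integrand (q + 1) y y0.
  have [dD _] := is_deriveD dq (is_deriveZ q dqS).
  exact: dD.
have Fy : F y @[y --> +oo] --> 0.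
  apply: (@squeeze_cvgr _ _ _ _ (fun y => - expR (- y)) (cst 0)).
  - near=> y; rewrite /F /cst oppr_le0 gamma_integrand_ge0 andbT lerN2.
    rewrite /gamma_integrand ler_piMl ?expR_ge0// powRN.
    have y1 : 1 <= y by near: y; exact: nbhs_pinfty_ge.
    have y0 : 0 < y by exact: lt_le_trans ltr01 y1.
    rewrite invf_le1 ?powR_gt0//.
    by rewrite -[leLHS](powRr0 y) ler_powR.
  - by rewrite -oppr0; apply: cvgN; exact: cvgr_expR.
  - exact: cvg_cst.
have f0' y : s <= y -> 0 <= f y by [].
have intf : (\int[mu]_(y in `[s, +oo[) (f y)%:E = (gamma_integrand q s)%:E)%E.
  rewrite (ge0_continuous_FTC2y f0' cf Fy).
  - by rewrite -EFinB /F sub0r opprK.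
  - by move=> y sy; apply: ex_derive; apply: dF; exact: lt_trans sy.
  - by apply: cvg_at_right_filter; exact: cF.
  - move=> y; rewrite in_itv/= andbT => sy.
    have dFy := dF y (lt_trans s0 sy).
    by rewrite derive1E derive_val.
have mf : measurable_fun `[s, +oo[ f.
  by apply: subspace_continuous_measurable_fun.
have if_ : mu.-integrable `[s, +oo[ (EFin \o f).
  apply/integrableP; split; first exact/measurable_EFinP.
  have -> : (\int[mu]_(x in `[s, +oo[) `|(EFin \o f) x| =
             \int[mu]_(y in `[s, +oo[) (f y)%:E)%E.
    by apply: eq_integral => y _; rewrite /= ger0_norm.
  by rewrite intf ltry.
have gf y : s <= y -> gamma_integrand q y <= f y.
  by move=> sy; rewrite lerDl mulr_ge0// gamma_integrand_ge0.
have ig : mu.-integrable `[s, +oo[ (EFin \o gamma_integrand q).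
  apply: le_integrable if_ => //.
    by apply/measurable_EFinP; exact: measurable_gamma_integrand.
  move=> y; rewrite /= in_itv/= andbT => sy.
  by rewrite lee_fin !ger0_norm ?gamma_integrand_ge0 ?gf.
have intfR : \int[mu]_(y in `[s, +oo[) f y = gamma_integrand q s.
  by rewrite /Rintegral intf.
split=> //=; rewrite -intfR; apply/andP; split.
  apply: le_Rintegral => // y; rewrite /= in_itv/= andbT; exact: gf.
rewrite -RintegralZl//; apply: le_Rintegral => //.
  by apply: eq_integrable (integrableZl _ (1 + q / s) ig).
move=> y; rewrite /= in_itv/= andbT => sy.
have y0 : 0 < y by exact: lt_le_trans sy.
rewrite fE// mulrC ler_wpM2r ?gamma_integrand_ge0// lerD2l ler_wpM2l//.
by rewrite lef_pV2 ?posrE.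
Unshelve. all: by end_near. Qed.

End GammaLimits.

Lemma integrable_setU_disj d (T : measurableType d) (R : realType)
    (mu : {measure set T -> \bar R}) (A B : set T) (f : T -> \bar R) :
    measurable A -> measurable B -> [disjoint A & B] ->
    mu.-integrable A f -> mu.-integrable B f -> mu.-integrable (A `|` B) f.
Proof.
move=> mA mB AB /integrableP[mfA fA] /integrableP[mfB fB].
have mf : measurable_fun (A `|` B) f by apply/measurable_funU.
apply/integrableP; split => //.
rewrite ge0_integral_setU//; first exact: lte_add_pinfty.
exact: measurableT_comp.
Qed.

(** * Dominated convergence for the substituted integrals *)

Section GDLimits.
Context {R : realType}.
Notation mu := (@lebesgue_measure R).
Implicit Types (s q N : R).

(** Extending the integrands by 0 beyond [T n] puts all integrals on one ray. On their supports (1 -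
    x / T)^T <= exp (- x), so the Gamma integrand dominates. *)
Lemma cvg_gd_integral q s (T : nat -> R) : 0 <= s ->
    mu.-integrable `]s, +oo[ (EFin \o gamma_integrand q) ->
    T n @[n --> \oo] --> +oo ->
  \int[mu]_(x in `]s, (T n)]) gd_integrand q (T n) (T n) x @[n --> \oo] -->
  \int[mu]_(x in `]s, +oo[) gamma_integrand q x.
Proof.
move=> s0 ig Ty.
pose P n : set R := `]s, (T n)]%classic.
have -> : (fun n => \int[mu]_(x in `]s, (T n)]) gd_integrand q (T n) (T n) x) =
  (fun n => \int[mu]_(x in `]s, +oo[) (gd_integrand q (T n) (T n) \_ (P n)) x).
  apply/funext => n; rewrite -Rintegral_mkcondr; congr (Rintegral _ _ _).
  by apply/esym/setIidPr; apply: subset_itvl.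
apply: Rintegral_dominated_cvg ig _ => //.
- move=> n; apply: measurable_funTS.
  apply: (measurable_restrictT _ (measurable_itv _)).1.
  exact: measurable_gd_integrand.
- move=> x /=; rewrite in_itv/= andbT => sx.
  have x0 : 0 <= x by rewrite ltW// (le_lt_trans s0).
  apply: (@cvg_trans _ (gd_integrand q (T n) (T n) x @[n --> \oo])).
    apply: near_eq_cvg; near=> n.
    rewrite patchE mem_set// /P /= in_itv/= sx/=.
    by near: n; exact: (cvgryPge _).1 Ty _.
  by apply: cvgMl_tmp; exact: cvg_powR_onem.
- move=> n x /=; rewrite in_itv/= andbT => sx.
  have x0 : 0 < x by exact: le_lt_trans sx.
  rewrite patchE; case: ifPn => [|_]; last first.
    by rewrite normr0 gamma_integrand_ge0.
  rewrite inE /P /= in_itv/= => /andP[_ xT].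
  have T0 : 0 < T n by exact: lt_le_trans xT.
  rewrite ger0_norm; last by rewrite mulr_ge0 ?powR_ge0.
  apply: ler_wpM2l; first exact: powR_ge0.
  have xT01 : 0 <= x / T n <= 1.
    by rewrite ler_pdivrMr// mul1r xT andbT divr_ge0// ltW.
  apply: (le_trans (powR_onem_le_expR _ _ (ltW T0) xT01)).
  by rewrite mulrC divfK// gt_eqF.
Unshelve. all: by end_near. Qed.

(** Extended by 0 to ]0, N], the integrands are eventually constant at each point and dominated by
    y^(-q), integrable since q < 1. *)
Lemma cvg_gd_integral0 q T N (u : nat -> R) : 0 < q < 1 -> 0 <= T -> 0 < N ->
    (forall n, 0 < u n) -> u n @[n --> \oo] --> (0 : R) ->
  \int[mu]_(x in `](u n), N]) gd_integrand q T N x @[n --> \oo] -->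
  \int[mu]_(x in `]0, N]) gd_integrand q T N x.
Proof.
move=> q01 T0 N0 u0 cvu.
pose P n : set R := `](u n), N]%classic.
have -> : (fun n => \int[mu]_(x in `](u n), N]) gd_integrand q T N x) =
  (fun n => \int[mu]_(x in `]0, N]) (gd_integrand q T N \_ (P n)) x).
  apply/funext => n; rewrite -Rintegral_mkcondr; congr (Rintegral _ _ _).
  by apply/esym/setIidPr; apply: subset_itvr; rewrite bnd_simp ltW.
apply: Rintegral_dominated_cvg (integrable_powR_itv0 q N q01) _ => //.
- move=> n; apply: measurable_funTS.
  apply: (measurable_restrictT _ (measurable_itv _)).1.
  exact: measurable_gd_integrand.
- move=> x /=; rewrite in_itv/= => /andP[x0 xN].
  apply: cvg_near_cst; near=> n.
  rewrite patchE mem_set// /P /= in_itv/= xN andbT.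
  by near: n; exact: (cvgr_lt _ cvu).
- move=> n x /=; rewrite in_itv/=.
  move=> /(gd_integrand_bounds q _ _ _ T0 N0)/andP[h0 h1].
  rewrite patchE; case: ifPn => [_|_]; last by rewrite normr0 powR_ge0.
  by rewrite ger0_norm.
Unshelve. all: by end_near. Qed.

Lemma integrable_gamma_integrand q : 0 < q < 1 ->
  mu.-integrable `]0, +oo[ (EFin \o gamma_integrand q).
Proof.
move=> q01; have /andP[q0 q1] := q01.
(* Split at 1: x^(-q) dominates below, and [gamma_tail] applies above. *)
rewrite (@itv_bndbnd_setU _ _ _ (BRight 1)) ?bnd_simp//.
apply: integrable_setU_disj => //.
- apply/disj_setPS => x [/=]; rewrite !in_itv/= andbT => /andP[_ x1].
  by rewrite ltNge x1.
- apply: le_integrable (integrable_powR_itv0 q 1 q01) => //.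
    by apply/measurable_EFinP; exact: measurable_gamma_integrand.
  move=> x /=; rewrite in_itv/= => /andP[x0 _].
  rewrite lee_fin !ger0_norm ?gamma_integrand_ge0 ?powR_ge0//.
  by rewrite ler_piMr ?powR_ge0// expR_le1 oppr_le0 ltW.
- have [ig _] := gamma_tail q 1 (ltW q0) ltr01.
  by apply: integrableS ig => //; apply: subset_itvr; rewrite bnd_simp.
Qed.

Lemma GammaE q : Gamma (1 - q) = \int[mu]_(x in `]0, +oo[) gamma_integrand q x.
Proof. by rewrite /Gamma /gamma_integrand addrAC subrr add0r. Qed.

(** The second inequality of [gamma_tail] at 1 makes the tail positive, and the nonnegative
    integrand makes the whole integral at least the tail. *)
Lemma Gamma_gt0 q : 0 < q < 1 -> 0 < Gamma (1 - q).
Proof.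
move=> q01; have /andP[q0 q1] := q01; rewrite GammaE.
have ig0 := integrable_gamma_integrand q q01.
have [ig] := gamma_tail q 1 (ltW q0) ltr01.
set I := Rintegral _ _ _ => /= /andP[_].
have g1 : 0 < gamma_integrand q 1 by rewrite mulr_gt0 ?powR_gt0 ?expR_gt0.
move=> /(lt_le_trans g1); rewrite pmulr_rgt0; last first.
  by rewrite divr1 addr_gt0.
move=> I0; apply: (lt_le_trans I0); rewrite /I.
rewrite [leLHS]Rintegral_mkcond [leRHS]Rintegral_mkcond.
apply: le_Rintegral => //.
- by rewrite -restrict_EFin; apply/integrable_restrict => //=; rewrite setTI.
- by rewrite -restrict_EFin; apply/integrable_restrict => //=; rewrite setTI.
move=> x _; rewrite !patchE; case: ifPn => [|_].
  rewrite inE/= in_itv/= andbT => x1.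
  by rewrite mem_set//= in_itv/= andbT (lt_le_trans ltr01).
by case: ifPn => // _; exact: gamma_integrand_ge0.
Qed.

End GDLimits.

(** * Limits of the loss ratio *)

Section Limits.
Context {R : realType}.
Implicit Types (p q x : R).

Lemma cvg_powR_pinfty p : 0 < p -> x `^ p @[x --> +oo] --> +oo.
Proof.
move=> p0; apply/cvgryPge => A; near=> x.
have A0 : 0 <= Num.max A 0 by rewrite le_max lexx orbT.
have xA : (Num.max A 0) `^ p^-1 <= x by near: x; exact: nbhs_pinfty_ge.
apply: (@le_trans _ _ (Num.max A 0)); first by rewrite le_max lexx.
rewrite -[leLHS]powRr1// -(mulVf (lt0r_neq0 p0)) powRrM.
apply: ge0_ler_powR => //; rewrite ?nnegrE ?powR_ge0 ?(ltW p0)//.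
Unshelve. all: by end_near. Qed.

Lemma cvg_natS_pinfty : n.+1%:R @[n --> \oo] --> (+oo : set_system R).
Proof. exact: (cvg_comp _ _ (cvg_addnl 1) cvgr_idn).
Qed.

Lemma cvg_natS_powR p : 0 < p ->
  n.+1%:R `^ p @[n --> \oo] --> (+oo : set_system R).
Proof.
by move=> p0; exact: (cvg_comp _ _ cvg_natS_pinfty (cvg_powR_pinfty p p0)).
Qed.

Lemma cvg_inv_pinfty (u : nat -> R) : u n @[n --> \oo] --> +oo ->
  (u n)^-1 @[n --> \oo] --> 0.
Proof.
move=> uy; have u0 : \forall n \near \oo, 0 < u n by exact: (cvgryPgt _).1 uy _.
exact: (gtr0_cvgV0 u0).2 uy.
Qed.

(** Dividing by a divergent [u] removes any bounded error. The coefficient [l] may vary with [n], so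
    that it can be an integral known only to converge. *)
Lemma cvg_div_bounded_error (a u l : nat -> R) (L C : R) :
    (\forall n \near \oo, `|a n - l n * u n| <= C) ->
    u n @[n --> \oo] --> +oo ->
    l n @[n --> \oo] --> L ->
  a n / u n @[n --> \oo] --> L.
Proof.
move=> aC uy lL.
have cv0 : a n / u n - l n @[n --> \oo] --> 0.
  apply: norm_cvg0.
  apply: (@squeeze_cvgr _ \oo _ _ (cst 0) (fun n => C * (u n)^-1));
    last 2 first.
  - exact: cvg_cst.
  - rewrite -[X in _ --> X](mulr0 C); apply: cvgMl_tmp.
    exact: cvg_inv_pinfty.
  near=> n.
  have un : 0 < u n by near: n; exact: (cvgryPgt _).1 uy _.
  rewrite normr_ge0/= ler_pdivlMr// -[X in _ * X]gtr0_norm// -normrM.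
  by rewrite mulrBl divfK ?gt_eqF//; near: n.
rewrite -[L]add0r; apply: cvg_trans (cvgD cv0 lL).
by apply: near_eq_cvg; near=> n; rewrite /= subrK.
Unshelve. all: by end_near. Qed.

End Limits.

(** * The rate as a ratio of sums, and its limit for [alpha < 1] *)

Section RateSequence.
Context {R : realType}.
Notation mu := (@lebesgue_measure R).
Implicit Types (alpha q s tau T N : R).

Definition gd_sum alpha T (n : nat) : R :=
  \sum_(k < n) gd_profile T (k.+1%:R `^ (- alpha)).

Lemma gd_profile_T0 (x : R) : gd_profile 0 x = x.
Proof. by rewrite /gd_profile powRr0 mulr1. Qed.

Lemma powRN_nat_itv alpha (k : nat) : 0 < alpha ->
  0 < k.+1%:R `^ (- alpha) <= (1 : R).
Proof.
move=> a0; rewrite powR_gt0//= powRN invf_le1 ?powR_gt0//.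
by rewrite -[leLHS](powRr0 k.+1%:R) ler_powR ?ler1n// ltW.
Qed.

Lemma rate_seqE alpha (p : forall d, 'I_d.+1 -> R) (c : forall d, 'M[R]_d.+1)
    (t : nat -> R -> R) tau (n : nat) :
    (forall d, power_law alpha (p d) (c d)) ->
  rate_seq p c t tau n =
  gd_sum alpha (2 * t n.+1 tau) n.+1 / gd_sum alpha 0 n.+1.
Proof.
move=> hpc; rewrite /rate_seq (excess_loss_ratioE alpha)// /gd_sum.
by under [X in _ = _ / X]eq_bigr => k _ do rewrite gd_profile_T0.
Qed.

Lemma gd_sum_ge1 alpha (n : nat) : 1 <= gd_sum alpha 0 n.+1.
Proof.
rewrite /gd_sum big_ord_recl gd_profile_T0 powR1 lerDl.
by apply: sumr_ge0 => k _; rewrite gd_profile_T0 powR_ge0.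
Qed.

(** The integral down to (n + 1)^(-alpha) matches the first [n] terms; the last term adds at most 1
    / (1 + T), which raises 2 to 3. *)
Lemma gd_sumS_approx alpha T N (n : nat) : 0 < alpha -> 0 <= T -> 0 < N ->
  `|gd_sum alpha T n.+1 -
    alpha^-1 * N `^ (alpha^-1 - 1) *
    \int[mu]_(s in `](N * n.+1%:R `^ (- alpha)), N])
      gd_integrand alpha^-1 T N s| <= 3 / (1 + T).
Proof.
move=> a0 T0 N0; have := sum_gd_profile_approx alpha T N n a0 T0 N0.
rewrite /gd_sum big_ord_recr/= -/(gd_sum alpha T n).
set K := _ * Rintegral _ _ _; set g := gd_profile _ _ => h.
have /andP[x0 x1] := powRN_nat_itv alpha n a0.
have g0 : 0 <= g by apply: gd_profile_ge0; exact: ltW.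
have g1 : g <= (1 + T)^-1 by apply: gd_profile_le => //; rewrite ltW.
rewrite addrAC (le_trans (ler_normD _ _))// (ger0_norm g0).
have -> : 3 / (1 + T) = 2 / (1 + T) + (1 + T)^-1 by field; lra.
exact: lerD.
Qed.

(** For T = 0 and N = 1 the integral is explicit: with its factor it equals (n^(1 - alpha) - 1) / (1
    - alpha), written here with n for [n.+1]. The constant part joins the bounded error. *)
Lemma cvg_gd_sum0_div alpha : 0 < alpha < 1 ->
  gd_sum alpha 0 n.+1 / n.+1%:R `^ (1 - alpha) @[n --> \oo] --> (1 - alpha)^-1.
Proof.
move=> /andP[a0 a1].
apply: (@cvg_div_bounded_error _ _ _ (fun=> (1 - alpha)^-1) _
  (3 + (1 - alpha)^-1)); last exact: cvg_cst.
- apply: nearW => n; have := gd_sumS_approx alpha 0 1 n a0 (lexx 0) ltr01.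
  rewrite powR1 mulr1 mul1r addr0 divr1.
  have -> : alpha^-1 * \int[mu]_(s in `]n.+1%:R `^ (- alpha), 1])
        gd_integrand alpha^-1 0 1 s =
      (1 - alpha)^-1 * n.+1%:R `^ (1 - alpha) - (1 - alpha)^-1.
    have -> : \int[mu]_(s in `]n.+1%:R `^ (- alpha), 1])
        gd_integrand alpha^-1 0 1 s =
        \int[mu]_(s in `]n.+1%:R `^ (- alpha), 1]) s `^ (- alpha^-1).
      by apply: eq_Rintegral => x _; rewrite /gd_integrand powRr0 mulr1.
    case: n => [|n].
      rewrite !powR1 set_itv_ge ?bnd_simp ?ltxx// Rintegral_set0; ring.
    have n0 : 0 < n.+2%:R `^ (- alpha) :> R by rewrite powR_gt0.
    rewrite Rintegral_powR//; last 2 first.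
    - rewrite powRN invf_lt1 ?powR_gt0//.
      have e : 1 `^ alpha = 1 :> R by rewrite powR1.
      by rewrite -[ltLHS]e gt0_ltr_powR ?nnegrE// ltr1n.
    - by rewrite addrC subr_eq0 lt_eqF// invf_gt1.
    rewrite powR1 -powRrM.
    have -> : - alpha * (- alpha^-1 + 1) = 1 - alpha by field; lra.
    by field; apply/andP; split; lra.
  have c0 : 0 <= (1 - alpha)^-1 by rewrite invr_ge0; lra.
  by rewrite !ler_norml => /andP[h1 h2]; apply/andP; split; lra.
- by apply: cvg_natS_powR; lra.
Qed.

Lemma expintE q tau : 0 < tau -> expint q tau =
  tau `^ (q - 1) * \int[mu]_(x in `[tau, +oo[) gamma_integrand q x.
Proof. by move=> t0; rewrite /expint gt_eqF. Qed.

(** Taking N = T fixes the lower endpoint at [tau], and N^(q - 1) becomes tau^(q - 1) times d^(1 -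
    alpha), the growth of the denominator. *)
Lemma cvg_rate_lt1 alpha tau : 0 < alpha < 1 -> 0 < tau ->
  gd_sum alpha (tau * n.+1%:R `^ alpha) n.+1 / gd_sum alpha 0 n.+1
    @[n --> \oo] --> (1 - alpha) / alpha * expint (1 / alpha) tau.
Proof.
move=> a01 t0; have /andP[a0 a1] := a01; rewrite div1r expintE//.
set q := alpha^-1; have q0 : 0 < q by rewrite invr_gt0.
pose T (n : nat) := tau * n.+1%:R `^ alpha.
have T0 n : 0 < T n by rewrite mulr_gt0// powR_gt0.
have Ty : T n @[n --> \oo] --> +oo.
  exact: cvg_comp _ _ (cvg_natS_powR alpha a0) (gt0_cvgMry t0 cvg_id).
have [ig _] := gamma_tail q tau (ltW q0) t0.
have ig' : mu.-integrable `]tau, +oo[ (EFin \o gamma_integrand q).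
  by apply: integrableS ig => //; apply: subset_itvr; rewrite bnd_simp.
rewrite -Rintegral_itv_obnd_cbnd//.
have cvI := cvg_gd_integral q tau T (ltW t0) ig' Ty.
set I := Rintegral _ _ _ in cvI *.
have num : gd_sum alpha (T n) n.+1 / n.+1%:R `^ (1 - alpha) @[n --> \oo] -->
    q * tau `^ (q - 1) * I.
  apply: (@cvg_div_bounded_error _ _ _ (fun n => q * tau `^ (q - 1) *
    \int[mu]_(x in `]tau, (T n)]) gd_integrand q (T n) (T n) x) _ 3).
  - apply: nearW => n.
    have := gd_sumS_approx alpha (T n) (T n) n a0 (ltW (T0 n)) (T0 n).
    have -> : T n * n.+1%:R `^ (- alpha) = tau.
      by rewrite /T powRN -mulrA divff ?mulr1// gt_eqF// powR_gt0.
    have -> : T n `^ (alpha^-1 - 1) = tau `^ (q - 1) * n.+1%:R `^ (1 - alpha).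
      rewrite /T powRM ?powR_ge0 ?ltW// -powRrM mulrBr divff ?gt_eqF//.
      by rewrite mulr1.
    rewrite -/q mulrA mulrAC => /le_trans; apply.
    by have T0n := T0 n; rewrite ler_piMr// invf_le1; lra.
  - by apply: cvg_natS_powR; lra.
  - exact: cvgMl_tmp.
have den := cvg_gd_sum0_div alpha a01.
have a1' : (1 - alpha)^-1 != 0 by rewrite invr_eq0; lra.
have -> : (1 - alpha) / alpha * (tau `^ (q - 1) * I) =
    q * tau `^ (q - 1) * I * ((1 - alpha)^-1)^-1 by rewrite invrK /q; ring.
have -> : (fun n => gd_sum alpha (tau * n.+1%:R `^ alpha) n.+1 /
      gd_sum alpha 0 n.+1) =
    (fun n => gd_sum alpha (T n) n.+1 / n.+1%:R `^ (1 - alpha) *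
      (gd_sum alpha 0 n.+1 / n.+1%:R `^ (1 - alpha))^-1).
  by apply/funext => n; rewrite invf_div mulrA divfK// gt_eqF// powR_gt0.
exact: cvgM num (cvgV a1' den).
Qed.

End RateSequence.

(** * Exponents above 1 *)

Section AboveOne.
Context {R : realType}.
Notation mu := (@lebesgue_measure R).
Implicit Types (alpha q s tau T N : R).

Lemma invr_itv01 alpha : 1 < alpha -> 0 < alpha^-1 < 1.
Proof. by move=> a1; rewrite invr_gt0 invf_lt1 ?a1 ?andbT; lra. Qed.

Lemma gd_sum_nondecreasing alpha T : nondecreasing_seq (gd_sum alpha T).
Proof.
apply/nondecreasing_seqP => n; rewrite /gd_sum big_ord_recr/= lerDl.
by apply: gd_profile_ge0; exact: powR_ge0.
Qed.

(** The partial sums increase and are bounded through the integral over all of ]0, 1], finite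
    because 1 / alpha < 1. *)
Lemma is_cvg_gd_sum alpha T : 1 < alpha -> 0 <= T -> cvgn (gd_sum alpha T).
Proof.
move=> a1 T0; have a0 : 0 < alpha by lra.
set q := alpha^-1; have q01 : 0 < q < 1 by exact: invr_itv01.
apply: nondecreasing_is_cvgn; first exact: gd_sum_nondecreasing.
exists (2 / (1 + T) + q * 1 `^ (q - 1) *
  \int[mu]_(s in `]0, 1]) gd_integrand q T 1 s) => _ [n _ <-].
have /ler_normlP[_] := sum_gd_profile_approx alpha T 1 n a0 T0 ltr01.
rewrite -/q -/(gd_sum alpha T n) lerBlDr => /le_trans; apply.
have /andP[q0 q1] := q01; rewrite lerD2l ler_wpM2l//.
  by rewrite mulr_ge0 ?powR_ge0// ltW.
have /andP[x0 x1] := powRN_nat_itv alpha n a0.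
have ig : mu.-integrable `]0, 1] (EFin \o gd_integrand q T 1).
  by apply: integrable_gd_integrand => //; exact: integrable_powR_itv0.
rewrite mul1r.
have := @Rintegral_itvB _ _ _ _ (n.+1%:R `^ (- alpha)) ig.
rewrite !bnd_simp => /(_ (ltW x0) x1) <-; rewrite lerBlDr lerDl.
apply: Rintegral_ge0 => x /=; rewrite in_itv/= => /andP[xgt0 xle].
have x01 : 0 < x <= 1 by rewrite xgt0 (le_trans xle).
by have /andP[] := gd_integrand_bounds q T 1 x T0 ltr01 x01.
Qed.

Definition gd_series alpha T : R := limn (gd_sum alpha T).

(** The error of [sum_gd_profile_approx] is uniform in [n], so it survives the limit, in which the
    lower endpoint tends to 0. *)
Lemma gd_series_approx alpha T N : 1 < alpha -> 0 <= T -> 0 < N ->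
  `|gd_series alpha T - alpha^-1 * N `^ (alpha^-1 - 1) *
    \int[mu]_(s in `]0, N]) gd_integrand alpha^-1 T N s| <= 2 / (1 + T).
Proof.
move=> a1 T0 N0; have a0 : 0 < alpha by lra.
have q01 := invr_itv01 alpha a1; set q := alpha^-1 in q01 *.
pose u (n : nat) := N * n.+1%:R `^ (- alpha).
have u0 n : 0 < u n by rewrite mulr_gt0// powR_gt0.
have cu : u n @[n --> \oo] --> (0 : R).
  rewrite -[X in _ --> X](mulr0 N); apply: cvgMl_tmp.
  under eq_fun do rewrite powRN.
  by apply: cvg_inv_pinfty; exact: cvg_natS_powR.
have cI := cvg_gd_integral0 q T N u q01 T0 N0 u0 cu.
have cS : gd_sum alpha T n @[n --> \oo] --> gd_series alpha T.
  exact: is_cvg_gd_sum.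
set I := Rintegral _ _ _ in cI *; set K := q * N `^ (q - 1).
have cK : gd_sum alpha T n - K * \int[mu]_(x in `](u n), N])
    gd_integrand q T N x @[n --> \oo] --> gd_series alpha T - K * I.
  by apply: cvgB cS _; exact: cvgMl_tmp.
apply: (@ler_cvg_to _ \oo _ _ _ (cst (2 / (1 + T))) _ _ (cvg_norm cK)).
  exact: cvg_cst.
by apply: nearW => n; exact: sum_gd_profile_approx.
Qed.

Lemma zetaE alpha : zeta alpha = gd_series alpha 0.
Proof.
rewrite /zeta /gd_series; congr (limn _); apply/funext => n.
rewrite /series/= big_mkord; apply: eq_bigr => k _.
by rewrite gd_profile_T0 powRN.
Qed.

Lemma zeta_gt0 alpha : 1 < alpha -> 0 < zeta alpha.
Proof.
move=> a1; rewrite zetaE; apply: (@lt_le_trans _ _ (gd_sum alpha 0 1)).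
  by apply: lt_le_trans (gd_sum_ge1 alpha 0).
apply: nondecreasing_cvgn_le; first exact: gd_sum_nondecreasing.
by apply: is_cvg_gd_sum.
Qed.

Lemma cvg_rate_gt1 alpha T : 1 < alpha -> 0 <= T ->
  gd_sum alpha T n.+1 / gd_sum alpha 0 n.+1 @[n --> \oo] -->
    gd_series alpha T / zeta alpha.
Proof.
move=> a1 T0; rewrite zetaE.
have z0 : gd_series alpha 0 != 0 by rewrite -zetaE gt_eqF// zeta_gt0.
have c1 := is_cvg_gd_sum alpha T a1 T0.
have c0 := is_cvg_gd_sum alpha 0 a1 (lexx 0).
have h : gd_sum alpha T n / gd_sum alpha 0 n @[n --> \oo] -->
    gd_series alpha T / gd_series alpha 0 by exact: cvgM c1 (cvgV z0 c0).
exact: (cvg_comp _ _ (cvg_addnl 1) h).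
Qed.

Lemma BetaE q T : 0 < q < 1 -> 0 <= T ->
  Beta (1 - q) (1 + T) = \int[mu]_(x in `]0, 1]) gd_integrand q T 1 x.
Proof.
move=> q01 T0.
have ig : mu.-integrable `]0, 1] (EFin \o gd_integrand q T 1).
  by apply: integrable_gd_integrand => //; exact: integrable_powR_itv0.
rewrite -Rintegral_itv_bndo_bndc; last first.
  by apply: integrableS ig => //; apply: subset_itvl; rewrite bnd_simp.
apply: eq_Rintegral => x _.
by rewrite /gd_integrand divr1 addrAC subrr add0r [1 + T]addrC addrK.
Qed.

(** Multiplication by T / T^q = T^(1 - q) turns the main term into q times an integral tending to
    [Gamma (1 - q)]. The error times T is at most [C], and division by T^q removes it. Both the
    series and the Beta function are instances. *)
Lemma cvg_gamma_scaled q (f : R -> R) (C : R) : 0 < q < 1 -> 0 <= C ->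
    (forall T, 0 < T -> `|f T - q * T `^ (q - 1) *
      \int[mu]_(s in `]0, T]) gd_integrand q T T s| <= C / (1 + T)) ->
  f T * T / T `^ q @[T --> +oo] --> q * Gamma (1 - q).
Proof.
move=> q01 C0 fC; have /andP[q0 q1] := q01.
apply/cvg_pinftyP => u uy; rewrite GammaE.
have ig := integrable_gamma_integrand q q01.
have cI := cvg_gd_integral q 0 u (lexx 0) ig uy.
apply: (@cvg_div_bounded_error _ _ _ (fun n => q *
  \int[mu]_(x in `]0, (u n)]) gd_integrand q (u n) (u n) x) _ C).
- near=> n.
  have un0 : 0 < u n by near: n; exact: (cvgryPgt _).1 uy _.
  have := fC _ un0; set I := Rintegral _ _ _ => h.
  have -> : f (u n) * u n - q * I * u n `^ q =
      (f (u n) - q * u n `^ (q - 1) * I) * u n.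
    have e : u n `^ q = u n * u n `^ (q - 1) by rewrite mulr_powRB1 ?ltW.
    by rewrite e; ring.
  rewrite normrM [X in _ * X]gtr0_norm// -ler_pdivlMr//.
  apply: (le_trans h); rewrite ler_wpM2l// lef_pV2 ?posrE//; lra.
- exact: (cvg_comp _ _ uy (cvg_powR_pinfty q q0)).
- exact: cvgMl_tmp.
Unshelve. all: by end_near. Qed.

Lemma cvg_mul2_pinfty : 2 * tau @[tau --> +oo] --> (+oo : set_system R).
Proof. by apply: gt0_cvgMry => //; exact: cvg_id. Qed.

Lemma cvg_gd_series_scaled alpha : 1 < alpha ->
  gd_series alpha T * T / T `^ alpha^-1 @[T --> +oo] -->
    alpha^-1 * Gamma (1 - alpha^-1).
Proof.
move=> a1; apply: (@cvg_gamma_scaled _ _ 2) => //; first exact: invr_itv01.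
by move=> T T0; apply: gd_series_approx => //; exact: ltW.
Qed.

(** The Beta term (scale N = 1) and the integral of scale N = T are both within 2 / (1 + T) of the
    same series, hence within 4 / (1 + T) of each other. *)
Lemma cvg_Beta_scaled alpha : 1 < alpha ->
  alpha^-1 * Beta (1 - alpha^-1) (1 + T) * T / T `^ alpha^-1 @[T --> +oo] -->
    alpha^-1 * Gamma (1 - alpha^-1).
Proof.
move=> a1; have q01 := invr_itv01 alpha a1.
apply: (@cvg_gamma_scaled _ _ 4) => // T T0.
have h2 := gd_series_approx alpha T T a1 (ltW T0) T0.
have := gd_series_approx alpha T 1 a1 (ltW T0) ltr01.
rewrite powR1 mulr1 -BetaE//; last exact: ltW.
move: (alpha^-1 * Beta _ _) (alpha^-1 * _ * _) h2 => X Y h2 h1.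
rewrite distrC in h1; apply: (le_trans (ler_distD (gd_series alpha T) _ _)).
have -> : 4 / (1 + T) = 2 / (1 + T) + 2 / (1 + T) by field; lra.
exact: lerD.
Qed.

(** Under the same scaling, the series and the Beta term have the same nonzero limit, so their ratio
    tends to 1. *)
Lemma asymp_equiv_rate_Beta alpha : 1 < alpha ->
  asymp_equiv (fun tau => gd_series alpha (2 * tau) / zeta alpha)
    (fun tau => Beta (1 - alpha^-1) (1 + 2 * tau) / (alpha * zeta alpha)).
Proof.
move=> a1; have q01 := invr_itv01 alpha a1; have /andP[q0 q1] := q01.
have z0 := zeta_gt0 alpha a1.
have G0 : alpha^-1 * Gamma (1 - alpha^-1) != 0.
  by rewrite gt_eqF// mulr_gt0// Gamma_gt0.
have c1 := cvg_comp _ _ cvg_mul2_pinfty (cvg_gd_series_scaled alpha a1).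
have c2 := cvg_comp _ _ cvg_mul2_pinfty (cvg_Beta_scaled alpha a1).
rewrite /asymp_equiv -[X in _ --> X](divff G0).
apply: cvg_trans (cvgM c1 (cvgV G0 c2)); apply: near_eq_cvg; near=> tau.
have t0 : 0 < tau by near: tau; exact: nbhs_pinfty_gt.
have p0 : 0 < (2 * tau) `^ alpha^-1 by rewrite powR_gt0// mulr_gt0.
rewrite /=; move: (Beta _ _) (gd_series _ _) => B G.
move: p0; move: (_ `^ _) => P P0.
(* If [B = 0], both sides are 0 by the convention that the inverse of 0 is 0. *)
have [->|B0] := eqVneq B 0; first by rewrite !(mul0r, mulr0, invr0).
by field; rewrite B0 !gt_eqF//; lra.
Unshelve. all: by end_near. Qed.

Lemma asymp_equiv_Beta_Gamma alpha : 1 < alpha ->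
  asymp_equiv
    (fun tau => Beta (1 - alpha^-1) (1 + 2 * tau) / (alpha * zeta alpha))
    (fun tau => Gamma (1 - alpha^-1) / (alpha * zeta alpha) *
      (1 / (2 * tau) `^ (1 - alpha^-1))).
Proof.
move=> a1; have q01 := invr_itv01 alpha a1; have /andP[q0 q1] := q01.
have z0 := zeta_gt0 alpha a1; have G0 := Gamma_gt0 _ q01.
have qG0 : alpha^-1 * Gamma (1 - alpha^-1) != 0 by rewrite gt_eqF// mulr_gt0.
have c2 := cvg_comp _ _ cvg_mul2_pinfty (cvg_Beta_scaled alpha a1).
rewrite /asymp_equiv -[X in _ --> X](divff qG0).
apply: cvg_trans (cvgMr_tmp c2); apply: near_eq_cvg; near=> tau.
have t0 : 0 < tau by near: tau; exact: nbhs_pinfty_gt.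
have T0 : 0 < 2 * tau by rewrite mulr_gt0.
have p0 : 0 < (2 * tau) `^ alpha^-1 by rewrite powR_gt0.
rewrite powRB ?(gt_eqF T0) ?implybT// powRr1 ?ltW//=.
move: (Beta _ _) => B.
move: p0 G0; move: (_ `^ _) (Gamma _) => P G P0 G0.
by field; rewrite !gt_eqF//; lra.
Unshelve. all: by end_near. Qed.

End AboveOne.

(** * The exponent 1 *)

Section AtOne.
Context {R : realType}.
Implicit Types (s tau T x : R).

Lemma ln_natS_pinfty : ln n.+1%:R @[n --> \oo] --> (+oo : set_system R).
Proof.
apply/cvgryPge => A; near=> n.
have n1 : expR A <= n.+1%:R by near: n; exact: (cvgryPge _).1 cvg_natS_pinfty _.
by rewrite -[A]expRK ler_ln ?posrE ?expR_gt0.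
Unshelve. all: by end_near. Qed.

(** Telescoping: the tangent of [ln] at the right end gives 1 / (m + 1) <= ln (m + 1) - ln m. The
    tangent at the left end gives the converse bound of [sum_inv_shift_ge]. *)
Lemma sum_inv_shift_le s (n : nat) : 0 < s ->
  \sum_(k < n) (k.+1%:R + s)^-1 <= ln (n%:R + s) - ln s.
Proof.
move=> s0; elim: n => [|n IH]; first by rewrite big_ord0 add0r subrr.
rewrite big_ord_recr/=.
have n0 : 0 < n%:R + s by rewrite ltr_wpDl.
have n1 : 0 < n.+1%:R + s by rewrite ltr_wpDl.
have := ln_frac_le (n.+1%:R + s) (n%:R + s) n1 n0.
rewrite ln_div ?posrE//.
have -> : (n%:R + s - (n.+1%:R + s)) / (n.+1%:R + s) = - (n.+1%:R + s)^-1.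
  by rewrite -natr1; field; lra.
lra.
Qed.

Lemma sum_inv_shift_ge s (n : nat) : 0 <= s ->
  ln (n.+1%:R + s) - ln (1 + s) <= \sum_(k < n) (k.+1%:R + s)^-1.
Proof.
move=> s0; elim: n => [|n IH]; first by rewrite big_ord0 subrr.
rewrite big_ord_recr/=.
have n1 : 0 < n.+1%:R + s by rewrite ltr_wpDr.
have n2 : 0 < n.+2%:R + s by rewrite ltr_wpDr.
have := ln_frac_le (n.+1%:R + s) (n.+2%:R + s) n1 n2.
rewrite ln_div ?posrE//.
have -> : (n.+2%:R + s - (n.+1%:R + s)) / (n.+1%:R + s) = (n.+1%:R + s)^-1.
  by rewrite -[n.+2%:R]natr1; field; lra.
lra.
Qed.

(** Telescoping from 1 / (m + 1)^2 <= 1 / (m (m + 1)) = 1 / m - 1 / (m + 1). *)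
Lemma sum_inv_sqr_shift_le s (n : nat) : 0 < s ->
  \sum_(k < n) ((k.+1%:R + s) ^+ 2)^-1 <= s^-1.
Proof.
move=> s0; suff h :
    \sum_(k < n) ((k.+1%:R + s) ^+ 2)^-1 <= s^-1 - (n%:R + s)^-1.
  by apply: (le_trans h); rewrite gerBl invr_ge0 addr_ge0// ltW.
elim: n => [|n IH]; first by rewrite big_ord0 add0r subrr.
rewrite big_ord_recr/= -natr1; have := IH; set S := \sum_(k < n) _.
have n0 : 0 < n%:R + s by rewrite ltr_wpDl.
move: n0; rewrite -addrA [1 + s]addrC addrA; move: (n%:R + s) => m m0 h.
have e : m^-1 - (m + 1)^-1 = (m * (m + 1))^-1 by field; lra.
have : ((m + 1) ^+ 2)^-1 <= (m * (m + 1))^-1.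
  by rewrite lef_pV2 ?posrE ?exprn_gt0 ?mulr_gt0//; nra.
lra.
Qed.

Lemma gd_profile_inv_le T x : 0 <= T -> 1 <= x ->
  gd_profile T x^-1 <= (x + T)^-1.
Proof.
move=> T0 x1; have x0 : 0 < x by lra.
have xV : 0 <= x^-1 <= 1 by rewrite invr_ge0 (ltW x0) invf_le1.
apply: (@le_trans _ _ (x^-1 * (1 + T * x^-1)^-1)).
  apply: ler_wpM2l; first by case/andP: xV.
  apply: (le_trans (powR_onem_le_expR T x^-1 T0 xV)).
  by apply: expRN_le_inv1D; rewrite mulr_ge0//; case/andP: xV.
by rewrite -invfM mulrDr mulr1 mulrCA divff ?mulr1 ?gt_eqF.
Qed.

(** The form is chosen for the argument S / x: then x^(-1) times the left side is (x - S) / (x +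
    S)^2 = 1 / (x + S) - 2 S / (x + S)^2, whose sums are controlled. *)
Lemma expRN_ge x : 0 <= x -> (1 - x) / (1 + x) ^+ 2 <= expR (- x).
Proof.
move=> x0; have [x1|x1] := leP x 1; last first.
  apply: le_trans (expR_ge0 _); rewrite pmulr_lle0; first lra.
  by rewrite invr_gt0 exprn_gt0//; lra.
apply: le_trans (expR_ge1Dx _); rewrite ler_piMr//; first lra.
by rewrite invf_le1 ?exprn_gt0//; nra.
Qed.

(* [(x+1)^-1 * (1 - (x+1)^-1) ^ T = x^-1 * (1 - (x+1)^-1) ^ (T+1)], and
   [1 - (x+1)^-1 >= expR (- x^-1)]. *)
Lemma gd_profile_invS_ge T x : 0 <= T -> 1 <= x ->
  (x + (T + 1))^-1 - 2 * (T + 1) / (x + (T + 1)) ^+ 2 <=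
  gd_profile T (x + 1)^-1.
Proof.
move=> T0 x1; have x0 : 0 < x by lra.
have xE : 1 - (x + 1)^-1 = x / (x + 1) by field; lra.
have h : 0 < x / (x + 1) by rewrite divr_gt0//; lra.
have -> : gd_profile T (x + 1)^-1 = x^-1 * (1 - (x + 1)^-1) `^ (T + 1).
  rewrite /gd_profile xE powRD ?(gt_eqF h) ?implybT// powRr1 ?ltW//.
  by move: (_ `^ _) => P; field; lra.
have xV : 0 <= (x + 1)^-1 < 1.
  by rewrite invr_ge0 invf_lt1; lra.
have := expR_le_powR_onem (T + 1) (x + 1)^-1 (addr_ge0 T0 ler01) xV.
rewrite xE; have -> : (T + 1) * ((x + 1)^-1 / (x / (x + 1))) = (T + 1) / x.
  by field; lra.
move=> /(le_trans (expRN_ge ((T + 1) / x) _)).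
have Tx : 0 <= (T + 1) / x by rewrite divr_ge0//; lra.
move=> /(_ Tx) /(ler_wpM2l (_ : 0 <= x^-1)).
rewrite invr_ge0 => /(_ (ltW x0)); apply: le_trans.
rewrite le_eqVlt; apply/orP; left; apply/eqP.
by field; apply/andP; split; lra.
Qed.

Lemma gd_sum1_le T (n : nat) : 0 < T ->
  gd_sum 1 T n <= ln (n%:R + T) - ln T.
Proof.
move=> T0; apply: le_trans (sum_inv_shift_le T n T0).
apply: ler_sum => k _; rewrite powR_inv1//.
by apply: gd_profile_inv_le; [exact: ltW|rewrite ler1n].
Qed.

Lemma gd_sum1_ge T (n : nat) : 0 <= T ->
  ln (n.+1%:R + (T + 1)) - ln (1 + (T + 1)) - 2 <= gd_sum 1 T n.+1.
Proof.
move=> T0; rewrite /gd_sum big_ord_recl.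
have T1 : 0 < T + 1 by lra.
(* The first, nonnegative term is dropped, as the lower bound needs arguments x + 1 with x >= 1. The
   quadratic corrections add up to at most 2 (T + 1) / (T + 1) = 2. *)
apply: (@le_trans _ _ (\sum_(k < n) ((k.+1%:R + (T + 1))^-1 -
    2 * (T + 1) / (k.+1%:R + (T + 1)) ^+ 2))).
  rewrite sumrB -mulr_sumr.
  have h1 := sum_inv_shift_ge (T + 1) n (ltW T1).
  have := ler_wpM2l (ltW T1) (sum_inv_sqr_shift_le (T + 1) n T1).
  rewrite divff ?gt_eqF// => h2; rewrite -mulrA; lra.
rewrite ler_wpDl ?gd_profile_ge0 ?powR_ge0//.
apply: ler_sum => k _; rewrite powR_inv1// lift0 -[k.+2%:R]natr1.
by apply: gd_profile_invS_ge => //; rewrite ler1n.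
Qed.

(** With M the vocabulary size, 1 <= T <= M since 0 <= tau <= 1. Hence M + T <= 2 M and 2 + T <= 3 T
    cost ln 2 and ln 3, and ln T = tau ln M gives the main term. *)
Lemma gd_sum1_approx tau (n : nat) : 0 <= tau <= 1 ->
  `|gd_sum 1 (n.+1%:R `^ tau) n.+1 - (1 - tau) * ln n.+1%:R| <= 2 + ln 3.
Proof.
move=> /andP[t0 t1]; set M := n.+1%:R; set T := M `^ tau.
have M1 : 1 <= M by rewrite ler1n.
have M0 : 0 < M by lra.
have T0 : 0 < T by exact: powR_gt0.
have T1 : 1 <= T by rewrite /T -[leLHS](powRr0 M) ler_powR.
have TM : T <= M by rewrite /T -[leRHS](powRr1 (ltW M0)) ler_powR.
have lnT : ln T = tau * ln M by exact: ln_powR.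
have h1 := gd_sum1_le T n.+1 T0; have h2 := gd_sum1_ge T n (ltW T0).
have l2 : ln (M + T) <= ln 2 + ln M.
  by rewrite -lnM ?posrE// ler_ln ?posrE; lra.
have l3 : ln (1 + (T + 1)) <= ln 3 + ln T.
  by rewrite -lnM ?posrE// ler_ln ?posrE; lra.
have l4 : ln M <= ln (M + (T + 1)) by rewrite ler_ln ?posrE; lra.
have l5 : ln 2 <= ln 3 :> R by rewrite ler_ln ?posrE// ler_nat.
by rewrite ler_norml; apply/andP; split; rewrite -/M in h1 h2; lra.
Qed.

(** The upper logarithmic bound requires a positive shift, so the first term 1 is split off and the
    remaining terms are summed with shift 1. *)
Lemma gd_sum10_approx (n : nat) :
  `|gd_sum 1 0 n.+1 - ln n.+1%:R| <= (1 : R).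
Proof.
have zE m : gd_sum 1 0 m = \sum_(k < m) (k.+1%:R + 0)^-1 :> R.
  by apply: eq_bigr => k _; rewrite gd_profile_T0 powR_inv1// addr0.
have h1 := sum_inv_shift_ge 0 n.+1 (lexx (0 : R)).
have h2 := sum_inv_shift_le 1 n (ltr01 : 0 < 1 :> R).
have h3 : gd_sum 1 0 n.+1 = 1 + \sum_(k < n) (k.+1%:R + 1)^-1 :> R.
  rewrite zE big_ord_recl addr0 invr1; congr (_ + _).
  by apply: eq_bigr => k _; rewrite lift0 addr0 natr1.
have h4 : ln n.+1%:R <= ln n.+2%:R :> R by rewrite ler_ln ?posrE// ler_nat.
rewrite -zE !addr0 ln1 subr0 in h1; rewrite ln1 subr0 natr1 in h2.
by rewrite ler_norml; apply/andP; split; lra.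
Qed.

Lemma cvg_rate_eq1 tau : 0 <= tau <= 1 ->
  gd_sum 1 (n.+1%:R `^ tau) n.+1 / gd_sum 1 0 n.+1 @[n --> \oo] --> 1 - tau.
Proof.
move=> t01; pose L (n : nat) : R := ln n.+1%:R.
have num : gd_sum 1 (n.+1%:R `^ tau) n.+1 / L n @[n --> \oo] --> 1 - tau.
  apply: (@cvg_div_bounded_error _ _ _ (fun=> 1 - tau) _ (2 + ln 3)).
  - by apply: nearW => n; exact: gd_sum1_approx.
  - exact: ln_natS_pinfty.
  - exact: cvg_cst.
have den : gd_sum 1 0 n.+1 / L n @[n --> \oo] --> (1 : R).
  apply: (@cvg_div_bounded_error _ _ _ (fun=> 1) _ 1).
  - by apply: nearW => n; rewrite mul1r; exact: gd_sum10_approx.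
  - exact: ln_natS_pinfty.
  - exact: cvg_cst.
rewrite -[X in _ --> X]divr1.
apply: cvg_trans (cvgM num (cvgV (oner_neq0 R) den)).
apply: near_eq_cvg; near=> n.
have Ln : 0 < L n by near: n; exact: (cvgryPgt _).1 ln_natS_pinfty _.
by rewrite /= invf_div mulrA divfK// gt_eqF.
Unshelve. all: by end_near. Qed.

End AtOne.

(** * Asymptotics of the exponential integral *)

Section ExpintAsymptotics.
Context {R : realType}.
Implicit Types (q tau : R).

(** The quotient equals (I / g(tau)) (1 + 1 / tau) with g the Gamma integrand and I its tail, and
    [gamma_tail] puts I / g(tau) between 1 / (1 + q / tau) and 1. *)
Lemma asymp_equiv_expint q : 0 <= q ->
  asymp_equiv (expint q) (fun tau => expR (- tau) / (tau + 1)).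
Proof.
move=> q0; rewrite /asymp_equiv.
have inv0 : (tau : R)^-1 @[tau --> +oo] --> 0.
  have t0 : \forall tau \near +oo, 0 < tau :> R by exact: nbhs_pinfty_gt.
  exact: (gtr0_cvgV0 t0).2 cvg_id.
apply: (@squeeze_cvgr _ _ _ _ (fun tau => (1 + q * tau^-1)^-1)
  (fun tau => 1 + tau^-1)); last 2 first.
- rewrite -[X in _ --> X]invr1; apply: cvgV; first exact: oner_neq0.
  rewrite -[X in _ --> X]addr0; apply: cvgD; first exact: cvg_cst.
  by rewrite -[X in _ --> X](mulr0 q); exact: cvgMl_tmp.
- by rewrite -[X in _ --> X]addr0; apply: cvgD => //; exact: cvg_cst.
near=> tau.
have t0 : 0 < tau by near: tau; exact: nbhs_pinfty_gt.
have [_] := gamma_tail q tau q0 t0.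
rewrite expintE//; set I := Rintegral _ _ _ => /= /andP[h1 h2].
have -> : tau `^ (q - 1) * I / (expR (- tau) / (tau + 1)) =
    I / gamma_integrand q tau * (1 + tau^-1).
  rewrite /gamma_integrand powRN powRB ?(gt_eqF t0) ?implybT// powRr1 ?ltW//.
  have := powR_gt0 q t0; have := expR_gt0 (- tau).
  move: (_ `^ _) (expR _) => P E E0 P0.
  by field; rewrite !gt_eqF//; lra.
have g0 : 0 < gamma_integrand q tau by rewrite mulr_gt0 ?powR_gt0 ?expR_gt0.
move: (gamma_integrand q tau) g0 h1 h2 => g g0 h1 h2.
have qt : 0 <= q * tau^-1 by rewrite mulr_ge0// invr_ge0 ltW.
have tV : 0 < tau^-1 by rewrite invr_gt0.
have I0 : 0 < I by rewrite -(pmulr_rgt0 I (_ : 0 < 1 + q * tau^-1)); lra.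
apply/andP; split.
  apply: (@le_trans _ _ (I / g)).
    by rewrite ler_pdivlMr// mulrC ler_pdivrMr; lra.
  by rewrite ler_peMr// ?divr_ge0 ?ltW//; lra.
rewrite ler_piMl//; first lra.
by rewrite ler_pdivrMr// mul1r.
Unshelve. all: by end_near. Qed.

End ExpintAsymptotics.

(* In the last equivalence the power is [(2 * tau) `^ _], not [tau `^ _]:
   since [Beta a (1 + 2 * tau)] is equivalent to [Gamma a / (2 * tau) `^ a],
   the equivalence with [C / tau `^ a] for this [C] is false by the constant
   factor [2 `^ a]. *)
Theorem theorem3p1 (R : realType) (alpha : R) (halpha : 0 < alpha)
    (p : forall d : nat, 'I_d.+1 -> R) (c : forall d : nat, 'M[R]_d.+1)
    (hpc : forall d : nat, power_law alpha (p d) (c d)) :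
  (alpha < 1 ->
    let t := fun (d : nat) (tau : R) => 1 / 2 * tau * d%:R `^ alpha in
    (forall tau : R, 0 <= tau ->
       cvgn (rate_seq p c t tau) /\
       asymptotic_rate p c t tau =
         (1 - alpha) / alpha * expint (1 / alpha) tau) /\
    asymp_equiv (asymptotic_rate p c t)
      (fun tau => (1 - alpha) / alpha * (expR (- tau) / (tau + 1))))
  /\
  (alpha = 1 ->
    let t := fun (d : nat) (tau : R) => 1 / 2 * d%:R `^ tau in
    forall tau : R, 0 <= tau <= 1 ->
      cvgn (rate_seq p c t tau) /\ asymptotic_rate p c t tau = 1 - tau)
  /\
  (1 < alpha ->
    let t := fun (d : nat) (tau : R) => tau in
    let C := Gamma (1 - 1 / alpha) / (alpha * zeta alpha) in
    let b := fun tau : R =>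
      Beta (1 - 1 / alpha) (1 + 2 * tau) / (alpha * zeta alpha) in
    (forall tau : R, 0 <= tau -> cvgn (rate_seq p c t tau)) /\
    asymp_equiv (asymptotic_rate p c t) b /\
    asymp_equiv b (fun tau => C * (1 / (2 * tau) `^ (1 - 1 / alpha)))).

Proof.
split; [|split].
- move=> a1 t; have a01 : 0 < alpha < 1 by rewrite halpha.
  have rate (tau : R) : 0 <= tau -> rate_seq p c t tau @ \oo -->
      (1 - alpha) / alpha * expint (1 / alpha) tau.
    have -> : rate_seq p c t tau = fun n =>
        gd_sum alpha (tau * n.+1%:R `^ alpha) n.+1 / gd_sum alpha 0 n.+1.
      apply/funext => n; rewrite (rate_seqE alpha p c t tau n hpc) /t.
      by congr (gd_sum _ _ _ / _); field.
    (* At [tau = 0] the two sums coincide, and the value chosen for [expint] at 0 makes the claimed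
       rate equal to 1. *)
    rewrite le_eqVlt => /predU1P[<-|]; last exact: cvg_rate_lt1.
    have -> : (1 - alpha) / alpha * expint (1 / alpha) 0 = 1.
      by rewrite /expint eqxx; field; apply/andP; split; lra.
    apply: cvg_near_cst; apply: nearW => n.
    by rewrite mul0r divff// gt_eqF// (lt_le_trans ltr01)// gd_sum_ge1.
  have rateE (tau : R) : 0 <= tau -> asymptotic_rate p c t tau =
      (1 - alpha) / alpha * expint (1 / alpha) tau.
    by move=> t0; apply: cvg_lim => //; exact: rate.
  split=> [tau t0|].
    by split; [apply/cvg_ex; eexists; exact: rate|exact: rateE].
  have q0 : 0 <= 1 / alpha by rewrite divr_ge0// ltW.
  apply: cvg_trans (asymp_equiv_expint _ q0); apply: near_eq_cvg; near=> tau.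
  have t0 : 0 <= tau by near: tau; exact: nbhs_pinfty_ge.
  have k0 : (1 - alpha) / alpha != 0 by rewrite gt_eqF// divr_gt0//; lra.
  by rewrite rateE// [in RHS]invfM mulrACA divff// [RHS]mul1r.
- move=> a1 t tau t01.
  have rate : rate_seq p c t tau @ \oo --> 1 - tau.
    have -> : rate_seq p c t tau = fun n =>
        gd_sum 1 (n.+1%:R `^ tau) n.+1 / gd_sum 1 0 n.+1.
      apply/funext => n; rewrite (rate_seqE alpha p c t tau n hpc) /t a1.
      by congr (gd_sum _ _ _ / _); field.
    exact: cvg_rate_eq1.
  by split; [apply/cvg_ex; eexists; exact: rate|by apply: cvg_lim].
- move=> a1 t C b; rewrite /b /C div1r.
  have rate (tau : R) : 0 <= tau -> rate_seq p c t tau @ \oo -->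
      gd_series alpha (2 * tau) / zeta alpha.
    move=> t0; have -> : rate_seq p c t tau = fun n =>
        gd_sum alpha (2 * tau) n.+1 / gd_sum alpha 0 n.+1.
      by apply/funext => n; exact: (rate_seqE alpha p c t tau n hpc).
    by apply: cvg_rate_gt1 => //; exact: mulr_ge0.
  split; first by move=> tau t0; apply/cvg_ex; eexists; exact: rate.
  split; last exact: asymp_equiv_Beta_Gamma.
  apply: cvg_trans (asymp_equiv_rate_Beta _ a1); apply: near_eq_cvg.
  near=> tau; have t0 : 0 <= tau by near: tau; exact: nbhs_pinfty_ge.
  by congr (_ / _); apply/esym/cvg_lim => //; exact: rate.
Unshelve. all: by end_near. Qed.
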